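(* Let $\Omega$ be a compact domain, with smooth boundary $\partial\Omega$, in an almost complex manifold $(M,J)$, let $g$ be a smooth complex-valued $(1,1)$-form on $\Omega$, and let $\phi:\partial\Omega\to\mathbb{C}$ be smooth. Then the Dirichlet problem $$\partial\bar\partial u=g\quad\text{with}\quad u|_{\partial\Omega}=\phi,$$ has at most one solution $u:\Omega\to\mathbb{C}$. In particular, if $(M,J)$ is a compact connected almost complex manifold and $f:M\to\mathbb{C}$ is a smooth map of almost complex manifolds, then $f$ is constant.
   Context: An almost complex manifold $(M,J)$ is a smooth manifold $M$ with an endomorphism $J$ of $TM$ satisfying $J^2=-\mathrm{Id}$; $J$ is not assumed integrable. Complex-valued forms are bigraded by $J$ into forms of type $(p,q)$, and the exterior differential decomposes as $d=\bar\mu+\bar\partial+\partial+\mu$, with components of bidegrees $|\bar\mu|=(-1,2)$, $|\bar\partial|=(0,1)$, $|\partial|=(1,0)$, $|\mu|=(2,-1)$. Thus for a smooth function $u$, $\bar\partial u$ is the $(0,1)$-part of $du$, and $\partial\bar\partial u$ is the $(1,1)$-part of $d(\bar\partial u)$. Domains are understood to be connected, and solutions $u$ are understood to be smooth. A smooth map of almost complex manifolds is a smooth map whose differential commutes with the almost complex structures; here $\mathbb{C}$ carries its standard complex structure, so that such a map $f:M\to\mathbb{C}$ satisfies $\bar\partial f=0$.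
   Formalization: The boundary ∂Ω is assumed nonempty in the uniqueness claim; if Ω is a closed manifold with ∂Ω empty, adding a constant to a solution gives another one, so uniqueness fails. *)

(* Defs.v *)
From mathcomp Require Export all_boot all_order all_algebra.
From mathcomp Require Export all_classical all_reals all_analysis.
From mathcomp Require Export complex.
Set Implicit Arguments.
Unset Strict Implicit.
Unset Printing Implicit Defensive.
Import Order.TTheory GRing.Theory Num.Theory.
Import numFieldNormedType.Exports.
Local Open Scope classical_set_scope.
Local Open Scope ring_scope.
Local Open Scope complex_scope.

(* On an open subset U of R^n, f is C^oo iff all its iterated directional
   derivatives exist and are differentiable at every point of U. *)
Definition iter_derive (R : realType) (n : nat) (W : normedModType R)
    (vs : seq 'rV[R]_n) (f : 'rV[R]_n -> W) : 'rV[R]_n -> W :=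
  foldr (fun v h x => 'D_v h x) f vs.

Definition smooth_on (R : realType) (n : nat) (W : normedModType R)
    (U : set 'rV[R]_n) (f : 'rV[R]_n -> W) : Prop :=
  forall (vs : seq 'rV[R]_n) (x : 'rV[R]_n),
    U x -> differentiable (iter_derive vs f) x.

(* A chart is a homeomorphism from an open subset of M onto an open subset of
   R^n; the values of coord outside cdom, and of param outside the image of
   cdom, are irrelevant. *)
Record chart (R : realType) (n : nat) (M : topologicalType) := Chart {
  cdom : set M;
  coord : M -> 'rV[R]_n;
  param : 'rV[R]_n -> M;
  cdom_open : open cdom;
  cimg_open : open (coord @` cdom);
  coordK : forall p, cdom p -> param (coord p) = p;
  coord_continuous : forall p, cdom p -> {for p, continuous coord};
  param_continuous :
    forall x, (coord @` cdom) x -> {for x, continuous param} }.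

Record manifold (R : realType) (n : nat) := Manifold {
  mspace :> topologicalType;
  mhausdorff : hausdorff_space mspace;
  msecond_countable : @second_countable mspace;
  mindex : Type;
  mchart : mindex -> chart R n mspace;
  mchart_cover : forall p : mspace, exists c : mindex, cdom (mchart c) p;
  mchart_compatible : forall c c' : mindex,
    smooth_on (coord (mchart c) @` (cdom (mchart c) `&` cdom (mchart c')))
              (coord (mchart c') \o param (mchart c)) }.

(* Tensor fields on M are families of components indexed by the charts c of the
   atlas and the points p of M (only points of the domain of c matter), subject
   to the transformation rule under changes of charts. Tangent vectors are row
   vectors v, with change of coordinates v |-> v *m transition c c' p. *)
Definition transition (R : realType) (n : nat) (M : manifold R n)
    (c c' : mindex M) (p : M) : 'M[R]_n :=
  lin1_mx ('d (coord (mchart c') \o param (mchart c)) (coord (mchart c) p)).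

(* In the chart c, the endomorphism J of T_p M is v |-> v *m acJ c p. *)
Record almost_complex_manifold (R : realType) (n : nat) :=
    AlmostComplexManifold {
  acbase :> manifold R n;
  acJ : mindex acbase -> acbase -> 'M[R]_n;
  acJ_sqr : forall (c : mindex acbase) (p : acbase), cdom (mchart c) p ->
    acJ c p *m acJ c p = - 1%:M;
  acJ_transition : forall (c c' : mindex acbase) (p : acbase),
    cdom (mchart c) p -> cdom (mchart c') p ->
    acJ c p *m transition c c' p = transition c c' p *m acJ c' p;
  acJ_smooth : forall c : mindex acbase,
    smooth_on (coord (mchart c) @` cdom (mchart c))
              (acJ c \o param (mchart c)) }.

Definition smooth_open (R : realType) (n : nat) (M : manifold R n)
    (U : set M) (f : M -> R) : Prop :=
  forall c : mindex M,
    smooth_on (coord (mchart c) @` (cdom (mchart c) `&` U))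
              (f \o param (mchart c)).

Definition csmooth_open (R : realType) (n : nat) (M : manifold R n)
    (U : set M) (f : M -> R[i]) : Prop :=
  smooth_open U (fun p => complex.Re (f p)) /\
  smooth_open U (fun p => complex.Im (f p)).

(* h is smooth in a neighbourhood of p in M, where it coincides with f on A.
   Functions on A are represented by total functions on M whose values
   outside A are irrelevant. *)
Definition smooth_extension (R : realType) (n : nat) (M : manifold R n)
    (A : set M) (f : M -> R[i]) (p : M) (h : M -> R[i]) : Prop :=
  exists U : set M, [/\ open U, U p, csmooth_open U h &
    forall q, A q -> U q -> h q = f q].

(* For arbitrary A: f : A -> C extends to a smooth function near each point
   of A. *)
Definition csmooth (R : realType) (n : nat) (M : manifold R n)
    (A : set M) (f : M -> R[i]) : Prop :=
  forall p, A p -> exists h, smooth_extension A f p h.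

Definition boundary (T : topologicalType) (A : set T) : set T :=
  closure A `\` interior A.

Definition compact_domain (R : realType) (n : nat) (M : manifold R n)
    (Om : set M) : Prop :=
  compact Om /\ connected Om.

(* Near each of its boundary points, Om is the sublevel set {rho <= 0} of a
   smooth function rho with nonvanishing differential. *)
Definition smooth_boundary (R : realType) (n : nat) (M : manifold R n)
    (Om : set M) : Prop :=
  forall p, boundary Om p -> exists (U : set M) (rho : M -> R),
    [/\ open U, U p, smooth_open U rho,
        forall c : mindex M, cdom (mchart c) p ->
          exists v : 'rV[R]_n,
            'D_v (rho \o param (mchart c)) (coord (mchart c) p) != 0 &
        forall q, U q -> (Om q <-> rho q <= 0)].

(* Complex-valued forms at a point, in coordinates: a 1-form is the column of
   its values on the coordinate vectors, alpha(v) = v *m a, and a 2-form is the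
   alternating matrix B of its values, beta(v, w) = v *m B *m w^T; both are
   extended complex-linearly to the complexified tangent space. *)

Definition cderive (R : realType) (n : nat) (v : 'rV[R]_n)
    (f : 'rV[R]_n -> R[i]) (x : 'rV[R]_n) : R[i] :=
  ('D_v (fun y => complex.Re (f y)) x) +i* ('D_v (fun y => complex.Im (f y)) x).

Definition d0 (R : realType) (n : nat)
    (f : 'rV[R]_n -> R[i]) (x : 'rV[R]_n) : 'cV[R[i]]_n :=
  \col_i cderive (delta_mx 0 i) f x.

Definition d1 (R : realType) (n : nat)
    (a : 'rV[R]_n -> 'cV[R[i]]_n) (x : 'rV[R]_n) : 'M[R[i]]_n :=
  \matrix_(i, j) (cderive (delta_mx 0 i) (fun y => a y j 0) x
                  - cderive (delta_mx 0 j) (fun y => a y i 0) x).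

Definition cmx (R : realType) (m n : nat) (A : 'M[R]_(m, n)) : 'M[R[i]]_(m, n) :=
  map_mx (real_complex R) A.

(* The projections v |-> v *m proj10 J and v |-> v *m proj01 J of the
   complexified tangent space onto the 'i- and (- 'i)-eigenspaces of J. *)
Definition proj10 (R : realType) (n : nat) (J : 'M[R]_n) : 'M[R[i]]_n :=
  2^-1 *: (1%:M - 'i *: cmx J).

Definition proj01 (R : realType) (n : nat) (J : 'M[R]_n) : 'M[R[i]]_n :=
  2^-1 *: (1%:M + 'i *: cmx J).

(* v |-> alpha(v^{0,1}) *)
Definition part01 (R : realType) (n : nat) (J : 'M[R]_n) (a : 'cV[R[i]]_n) :
    'cV[R[i]]_n :=
  proj01 J *m a.

(* (v, w) |-> beta(v^{1,0}, w^{0,1}) + beta(v^{0,1}, w^{1,0}) *)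
Definition part11 (R : realType) (n : nat) (J : 'M[R]_n) (B : 'M[R[i]]_n) :
    'M[R[i]]_n :=
  proj10 J *m B *m (proj01 J)^T + proj01 J *m B *m (proj10 J)^T.

(* dbar and deldbar give the components in the chart c of the (0,1)-part of du,
   as a function of the coordinates, and of the (1,1)-part of d(dbar u). *)
Definition dbar (R : realType) (n : nat) (M : almost_complex_manifold R n)
    (c : mindex M) (u : M -> R[i]) (x : 'rV[R]_n) : 'cV[R[i]]_n :=
  part01 (acJ c (param (mchart c) x)) (d0 (u \o param (mchart c)) x).

Definition deldbar (R : realType) (n : nat) (M : almost_complex_manifold R n)
    (c : mindex M) (u : M -> R[i]) (p : M) : 'M[R[i]]_n :=
  part11 (acJ c p) (d1 (dbar c u) (coord (mchart c) p)).

Record smooth_form11 (R : realType) (n : nat)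
    (M : almost_complex_manifold R n) (A : set M)
    (g : mindex M -> M -> 'M[R[i]]_n) : Prop := SmoothForm11 {
  form11_alternating : forall c p, A p -> cdom (mchart c) p ->
    (g c p)^T = - g c p;
  form11_type : forall c p, A p -> cdom (mchart c) p ->
    part11 (acJ c p) (g c p) = g c p;
  form11_transition : forall c c' p, A p ->
    cdom (mchart c) p -> cdom (mchart c') p ->
    g c p = cmx (transition c c' p) *m g c' p *m (cmx (transition c c' p))^T;
  form11_smooth : forall c i j,
    csmooth (A `&` cdom (mchart c)) (fun p => g c p i j) }.

(* At a boundary point p of Om, deldbar u is computed from a smooth extension
   of u across the boundary; as Om is the closure of its interior, the value
   does not depend on the extension. *)
Definition dirichlet_solution (R : realType) (n : nat)
    (M : almost_complex_manifold R n) (Om : set M)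
    (g : mindex M -> M -> 'M[R[i]]_n) (phi u : M -> R[i]) : Prop :=
  [/\ csmooth Om u,
      forall p, Om p -> forall (c : mindex M) (h : M -> R[i]),
        cdom (mchart c) p -> smooth_extension Om u p h ->
        deldbar c h p = g c p &
      forall p, boundary Om p -> u p = phi p].

(* f is smooth and df(J v) = 'i * df(v) for all tangent vectors v. *)
Definition almost_complex_map (R : realType) (n : nat)
    (M : almost_complex_manifold R n) (f : M -> R[i]) : Prop :=
  csmooth setT f /\
  forall (p : M) (c : mindex M), cdom (mchart c) p ->
    forall v : 'rV[R]_n,
      cmx (v *m acJ c p) *m d0 (f \o param (mchart c)) (coord (mchart c) p)
      = 'i *: (cmx v *m d0 (f \o param (mchart c)) (coord (mchart c) p)).

(* Main.v *)
(* The difference of two solutions, multiplied by any constant k, has a real part w with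
   dd^c w = 0 in the interior of Om and w = 0 on the boundary, so it suffices that a real
   function w with dd^c w = 0 near an interior maximum is constant there; compactness
   and connectedness do the rest.  Pairing dd^c w with (v, J v) gives, for every
   constant coordinate vector v, the degenerate elliptic equation
     D_v D_v w + D_{Jv} D_{Jv} w + (first order terms) = 0,
   in which the mixed second derivatives of the other part of the solution cancel by
   Young's theorem.  Hopf's barrier argument only needs this equation for one v, the
   normal to the touching sphere at the point of contact.  A map holomorphic for J is
   killed by dbar, so the maximum principle applies to it as well. *)
Require Import Defs.
From mathcomp Require Import ring lra.
Set Implicit Arguments.
Unset Strict Implicit.
Unset Printing Implicit Defensive.
Import Order.TTheory GRing.Theory Num.Theory.
Import numFieldNormedType.Exports.
Local Open Scope classical_set_scope.
Local Open Scope ring_scope.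
Local Open Scope complex_scope.

(** * Calculus along lines *)

(** Since [J] need not be integrable, there are no holomorphic coordinates; everything happens in
    real coordinates with a variable matrix [J x]. For a single v the operator D_v D_v + D_{Jv}
    D_{Jv} has rank at most two, and its own strong maximum principle is false: on C^2 it may ignore
    one complex variable altogether. Local constancy comes from having the equation for every v. The
    touching sphere is found first, and only then is v taken to be its normal at the point of
    contact, the one direction in which Hopf's barrier needs a positive coefficient. The decoupling
    of real and imaginary parts is visible on dbar u = (du + i J^* du) / 2. With u = a + i b, its
    imaginary part is (db + J^* da) / 2, and d kills db. The derivatives of [J] produced by d (J^*
    da) multiply first derivatives of a; no term of order zero appears. Only upper bounds for Re (k
    u) are proved; k = 1, -1, i, -i recover both parts of u with both signs. *)

Lemma near_normP {R : realType} {V : normedModType R} (P : V -> Prop) (x : V) :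
  (\forall y \near x, P y) <->
  exists2 d : R, 0 < d & forall y, `|y - x| < d -> P y.
Proof.
split=> [/nbhs_ballP[d /= d0 dP]|[d d0 dP]].
  by exists d => // y yx; apply: dP; rewrite -ball_normE /= distrC.
apply/nbhs_ballP; exists d => //= y; rewrite -ball_normE /= distrC.
exact: dP.
Qed.

Section line_calculus.
Context {R : realType} {V : normedModType R}.
Implicit Types (f : V -> R) (x v w : V).

(** Linear combinations are brought to the single shape [f y + e * h y], whence the otherwise odd
    [0 +] and [(-1) *] in later rewritings. *)
Lemma is_deriveDZ f (h : V -> R) x v a b (e : R) :
  is_derive x v f a -> is_derive x v h b ->
  is_derive x v (fun y => f y + e * h y) (a + e * b).
Proof. by move=> fa hb; have := is_deriveD fa (is_deriveZ e hb). Qed.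

Lemma is_deriveMr f (g : V -> R) a b x v :
  is_derive x v f a -> is_derive x v g b ->
  is_derive x v (fun y => f y * g y) (a * g x + f x * b).
Proof.
move=> fa gb; have := is_deriveM fa gb; rewrite addrC [g x *: a]mulrC; apply.
Qed.

Lemma is_derive_line f x v (t : R) (c : R) :
  is_derive (x + t *: v) v f c -> is_derive t 1 (fun s => f (x + s *: v)) c.
Proof.
have E : (fun h : R => h^-1 *: (((fun s => f (x + s *: v)) \o shift t) (h *: 1) - f (x + t *: v)))
   = (fun h : R => h^-1 *: ((f \o shift (x + t *: v)) (h *: v) - f (x + t *: v))).
  apply/funext => h /=; congr (_ *: (f _ - _)).
  by rewrite [h%:A]mulr1 scalerDl addrCA.
move=> [df dv]; apply: DeriveDef.
  by move: df; rewrite /derivable -E.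
by rewrite -dv /derive E.
Qed.

Lemma is_derive_translate f x w v (c : R) :
  is_derive (x + w) v f c -> is_derive x v (fun y => f (y + w)) c.
Proof.
have E : (fun h : R => h^-1 *: (((fun y => f (y + w)) \o shift x) (h *: v) - f (x + w)))
   = (fun h : R => h^-1 *: ((f \o shift (x + w)) (h *: v) - f (x + w))).
  by apply/funext => h /=; rewrite addrA.
move=> [df dv]; apply: DeriveDef.
  by move: df; rewrite /derivable -E.
by rewrite -dv /derive E.
Qed.

Lemma near_line (P : V -> Prop) x v :
  (\forall y \near x, P y) ->
  exists2 d : R, 0 < d & forall s : R, `|s| < d -> P (x + s *: v).
Proof.
move=> /near_normP[d d0 dP].
have v1 : 0 < `|v| + 1 by rewrite ltr_wpDl.
exists (d / (`|v| + 1)); first by rewrite divr_gt0.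
move=> s; rewrite ltr_pdivlMr// => sd; apply: dP.
rewrite addrC addKr normrZ; apply: le_lt_trans sd.
by rewrite ler_wpM2l// lerDl.
Qed.

Lemma MVT_line f (g : V -> R) x v (s : R) : 0 < s ->
  (forall t, 0 <= t <= s -> is_derive (x + t *: v) v f (g (x + t *: v))) ->
  exists2 t, 0 < t < s & f (x + s *: v) - f x = s * g (x + t *: v).
Proof.
move=> s0 dfg.
have [||t ts] := @MVT R (fun t => f (x + t *: v)) (fun t => g (x + t *: v)) 0 s s0.
- move=> t; rewrite in_itv /= => /andP[t0 ts].
  by apply: is_derive_line; apply: dfg; rewrite !ltW.
- apply: derivable_within_continuous => t; rewrite in_itv /= => ts.
  by have [] := is_derive_line (dfg t ts).
by rewrite scale0r addr0 subr0 mulrC => ->; exists t.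
Qed.

(** If c > 0, then g (x + s v) / s > 0 for small nonzero s, and the mean value theorem makes f (x +
    s v) exceed f x. The second derivative is taken at x alone, so Taylor's formula is avoided. *)
Lemma derive2_local_max f (g : V -> R) x v c :
  (\forall y \near x, f y <= f x) ->
  (\forall y \near x, is_derive y v f (g y)) ->
  is_derive x v g c -> g x = 0 /\ c <= 0.
Proof.
move=> mx dfg dg.
have [d d0 H] : exists2 d : R, 0 < d & forall s : R, `|s| < d ->
    f (x + s *: v) <= f x /\ is_derive (x + s *: v) v f (g (x + s *: v)).
  by apply: (near_line (P := fun y => f y <= f x /\ is_derive y v f (g y))); near do split.
have gx0 : g x = 0.
  pose phi (s : R) := f (x + s *: v).
  have H' t : t \in `]-d, d[%R -> phi t <= phi 0 /\ is_derive t 1 phi (g (x + t *: v)).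
    rewrite in_itv /= -ltr_norml => /H[h1 h2]; rewrite /phi scale0r addr0; split=> //.
    exact: is_derive_line.
  have d00 : 0 \in `]-d, d[%R by rewrite in_itv /= oppr_lt0 d0.
  have [_ E0] : is_derive (0 : R) 1 phi 0.
    apply: (@derive1_at_max _ _ (-d) d) => //.
    - by rewrite ge0_cp// ltW.
    - by move=> t /H'[_ []].
    - by move=> t /H'[].
  have [_ [_]] := H' _ d00.
  by rewrite E0 scale0r addr0 => <-.
split=> //; rewrite leNgt; apply/negP => c0.
have : is_derive (0 : R) 1 (fun s => g (x + s *: v)) c.
  by apply: is_derive_line; rewrite scale0r addr0.
move=> [dg' cE].
have : \forall h \near (0 : R)^', 0 < h^-1 *: (g (x + h *: v) - g x).
  have : (fun h : R => h^-1 *: (g (x + h *: v) - g x)) @ (0 : R)^' --> c.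
    rewrite -cE; move: dg'; rewrite /derivable /derive.
    under [X in cvg (X @ _)]eq_fun do rewrite /= addr0 scale0r addr0 [_%:A]mulr1.
    under [X in _ -> _ --> lim (X @ _)]eq_fun do rewrite /= addr0 scale0r addr0 [_%:A]mulr1.
    by [].
  by move=> /cvgr_gt; apply.
rewrite near_withinE => /near_normP[e e0 eP].
pose s := Num.min d e / 2.
have s0 : 0 < s by rewrite divr_gt0// lt_min d0.
have sd : s < d by rewrite /s; case: (ltP d e); lra.
have se : s < e by rewrite /s; case: (ltP d e); lra.
have [|t /andP[t0 ts]] := @MVT_line f g x v s s0.
  move=> t /andP[t0 ts]; apply: (H _ _).2; rewrite ger0_norm//; exact: le_lt_trans sd.
have := (H s _).1; rewrite gtr0_norm// => /(_ sd).
have : 0 < g (x + t *: v).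
  have /= := eP t; rewrite subr0 gtr0_norm// gx0 subr0 gt_eqF// => /(_ (lt_trans ts se) isT).
  by rewrite [_ *: _]mulrC pmulr_lgt0// invr_gt0.
by move=> gt0 le0 E; have := mulr_gt0 s0 gt0; rewrite -E subr_gt0 ltNge le0.
Unshelve. all: by end_near. Qed.

Lemma differentiable_near (g : V -> R) x (e : R) : differentiable g x -> 0 < e ->
  exists2 d, 0 < d & forall h, `|h| < d ->
    `|g (x + h) - g x - 'D_h g x| <= e * `|h|.
Proof.
move=> dg e0; have := diff_locally dg => /eqaddoP /(_ e e0).
move=> /near_normP[d d0 H]; exists d => // h hd.
rewrite deriveE//; have := H h; rewrite subr0 => /(_ hd).
by rewrite /= /cst !fctE opprD addrA [h + x]addrC.
Qed.

Lemma deriveD_dir (g : V -> R) x v w : differentiable g x ->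
  'D_(v + w) g x = 'D_v g x + 'D_w g x.
Proof. by move=> dg; rewrite !deriveE// linearD. Qed.

Lemma deriveZ_dir (g : V -> R) x (k : R) v : differentiable g x ->
  'D_(k *: v) g x = k * 'D_v g x.
Proof. by move=> dg; rewrite !deriveE// linearZ. Qed.

Lemma deriveN_dir (g : V -> R) x v : differentiable g x -> 'D_(- v) g x = - 'D_v g x.
Proof. by move=> dg; rewrite !deriveE// linearN. Qed.

(** The mean value theorem along v, applied to f (y + s w) - f y, turns the second difference into s
    times an increment of D_v f; differentiability of D_v f at x evaluates that increment up to
    o(s). *)
Lemma second_difference f x v w (e : R) : 0 < e ->
  (\forall y \near x, differentiable f y) -> differentiable ('D_v f) x ->
  exists2 d, 0 < d & forall s : R, 0 < s < d ->
    `|f (x + s *: v + s *: w) - f (x + s *: v) - f (x + s *: w) + f x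
      - s ^+ 2 * 'D_w ('D_v f) x| <= e * s ^+ 2.
Proof.
set g := 'D_v f => e0 /near_normP[d1 d10 df] dg.
(* For 0 <= t <= s the two remainders, at t v + s w and at t v, involve norms adding up to at most s
   (2 |v| + |w|). The [+ 1] keeps [N] positive when v = w = 0. *)
pose N := 2 * `|v| + `|w| + 1.
have N0 : 0 < N by rewrite ltr_wpDl// addr_ge0// mulr_ge0.
have [d2 d20 H] := differentiable_near dg (divr_gt0 e0 N0).
have vN : `|v| + `|w| < N by rewrite /N ltr_pwDr// lerD2r ler_peMl// ler1n.
exists (Num.min d1 d2 / N); first by rewrite divr_gt0// lt_min d10.
move=> s /andP[s0]; rewrite ltr_pdivlMr// => sd.
have small t r : 0 <= t <= s -> 0 <= r <= s -> `|t *: v + r *: w| < Num.min d1 d2.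
  move=> /andP[t0 ts] /andP[r0 rs]; apply: le_lt_trans sd.
  rewrite (le_trans (ler_normD _ _))// !normrZ !ger0_norm// (le_trans (y := s * (`|v| + `|w|)))//.
    by rewrite mulrDr lerD// ler_wpM2r.
  by rewrite ler_wpM2l// ltW.
have dfs t r : 0 <= t <= s -> 0 <= r <= s -> differentiable f (x + t *: v + r *: w).
  move=> ht hr; apply: df; rewrite -(addrA x) [x + _]addrC addrK.
  by apply: lt_le_trans (small _ _ ht hr) _; rewrite ge_min lexx.
have Hs t r : 0 <= t <= s -> 0 <= r <= s ->
    `|g (x + (t *: v + r *: w)) - g x - (t * 'D_v g x + r * 'D_w g x)|
     <= e / N * `|t *: v + r *: w|.
  move=> ht hr; rewrite -!deriveZ_dir// -deriveD_dir//; apply: H.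
  by apply: lt_le_trans (small _ _ ht hr) _; rewrite ge_min lexx orbT.
pose F y := f (y + s *: w) - f y.
pose G y := g (y + s *: w) - g y.
have s0s : 0 <= s <= s by rewrite lexx ltW.
have s00 : 0 <= (0 : R) <= s by rewrite lexx ltW.
have [|t /andP[t0 ts]] := @MVT_line F G x v s s0.
  move=> t ht; rewrite /F /G.
  have df1 := dfs t s ht s0s.
  have := dfs t 0 ht s00; rewrite scale0r addr0 => df2.
  apply: is_deriveB; last by apply: derivableP; exact: diff_derivable.
  by apply: is_derive_translate; apply: derivableP; exact: diff_derivable.
have ht : 0 <= t <= s by rewrite !ltW.
have := Hs t s ht s0s; have := Hs t 0 ht s00.
rewrite scale0r addr0 mul0r addr0 /F /G addrA => H2 H1 E.
have -> : f (x + s *: v + s *: w) - f (x + s *: v) - f (x + s *: w) + f x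
   = f (x + s *: v + s *: w) - f (x + s *: v) - (f (x + s *: w) - f x).
  by rewrite opprB addrA addrAC.
rewrite E expr2 -mulrA -mulrBr normrM gtr0_norm// mulrCA ler_wpM2l ?(ltW s0)//.
set a := g _ in H1 *; set b := g _ in H2 *; set p := 'D_v g x in H1 H2.
set q := 'D_w g x in H1 *.
have -> : a - b - s * q = (a - g x - (t * p + s * q)) - (b - g x - t * p) by ring.
have : e / N * `|t *: v + s *: w| + e / N * `|t *: v| <= e * s.
  rewrite -mulrDr -mulrA ler_wpM2l ?(ltW e0)// ler_pdivrMl//.
  have := ler_normD (t *: v) (s *: w); rewrite !normrZ !gtr0_norm// => tri.
  have : t * `|v| <= s * `|v| by rewrite ler_wpM2r// ltW.
  by rewrite /N; move: tri; have := ltW s0; lra.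
apply: le_trans; apply: le_trans (ler_normB _ _) _; exact: lerD.
Qed.

(** The second difference is symmetric in v and w, so after division by s^2 it tends to both mixed
    derivatives. *)
Lemma derive_comm f x v w :
  (\forall y \near x, differentiable f y) ->
  differentiable ('D_v f) x -> differentiable ('D_w f) x ->
  'D_w ('D_v f) x = 'D_v ('D_w f) x.
Proof.
move=> df dv dw; apply/eqP; rewrite -subr_eq0 -normr_le0 leNgt; apply/negP.
have key (a b : R) : a * b <= 2 * (b / 3 * a) -> 0 < a -> 0 < b -> False.
  by move=> ab a0 b0; have := mulr_gt0 a0 b0; lra.
set D := 'D_w _ _; set E := 'D_v _ _ => DE.
(* Two errors of a third each give |D - E| <= (2/3) |D - E|, a contradiction. *)
have e0 : 0 < `|D - E| / 3 by rewrite divr_gt0.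
have [d1 d10 H1] := second_difference w e0 df dv.
have [d2 d20 H2] := second_difference v e0 df dw.
pose s := Num.min d1 d2 / 2.
have s0 : 0 < s by rewrite divr_gt0// lt_min d10.
have s1 : 0 < s < d1 by rewrite s0 /s; case: (ltP d1 d2); lra.
have s2 : 0 < s < d2 by rewrite s0 /s; case: (ltP d1 d2); lra.
have := H1 _ s1; have := H2 _ s2; rewrite -/D -/E.
rewrite [x + s *: w + s *: v]addrAC; set A := f _; set B := f _; set C := f _.
move=> h1 h2.
have : s ^+ 2 * `|D - E| <= 2 * (`|D - E| / 3 * s ^+ 2).
  have s20 : 0 <= s ^+ 2 by rewrite exprn_ge0// ltW.
  rewrite -{1}[s ^+ 2]ger0_norm// -normrM.
  have -> : s ^+ 2 * (D - E) = (A - B - C + f x - s ^+ 2 * E) -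
     (A - C - B + f x - s ^+ 2 * D) by ring.
  rewrite mulr_natl mulr2n; exact: le_trans (ler_normB _ _) (lerD h1 h2).
have : 0 < s ^+ 2 by rewrite exprn_gt0.
by move=> s20 /key; apply.
Qed.

End line_calculus.

(** * The barrier function *)

(** Relative closedness is asked at points of [A] only, so that level sets of functions known to be
    continuous just on [A] are covered. *)
Lemma compact_subset_near (T : topologicalType) (A : set T) (P : T -> Prop) :
  compact A -> (forall x, A x -> ~ P x -> \forall y \near x, ~ P y) ->
  compact (A `&` P).
Proof.
move=> cA nP F PF FAP.
have [x [Ax clx]] := cA F PF (filterS (@subIsetl _ A P) FAP).
exists x; split=> //; split=> //; apply: contrapT => /(nP _ Ax) nPx.
by have [y [[_ Py] /(_ Py)]] := clx _ _ FAP nPx.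
Qed.

(** * Euclidean inner product on row vectors *)

Section dot.
Context {R : realType} {n : nat}.
Implicit Types (x y z v w : 'rV[R]_n).

(** The norm of ['rV[R]_n] is the sup norm, whose spheres are cubes. Touching spheres need a smooth
    squared distance and a normal, hence [dot]; neighbourhoods and compact balls keep the sup
    norm. *)
Definition dot x y : R := \sum_i x 0 i * y 0 i.

Lemma dotNN x y : dot (- x) (- y) = dot x y.
Proof. by apply: eq_bigr => i _; rewrite !mxE mulrNN. Qed.

Lemma dot0l x : dot 0 x = 0.
Proof. by rewrite /dot big1// => i _; rewrite mxE mul0r. Qed.

Lemma dot_ge0 x : 0 <= dot x x.
Proof. by apply: sumr_ge0 => i _; rewrite -expr2 sqr_ge0. Qed.

Lemma dot_ge_norm x : `|x| ^+ 2 <= dot x x.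
Proof.
rewrite -ler_sqrt ?dot_ge0// sqrtr_sqr normr_id.
rewrite {1}/Num.Def.normr/= mx_normrE bigmax_le ?sqrtr_ge0// => -[i j] _ /=.
rewrite -sqrtr_sqr ler_wsqrtr// /dot (bigD1 j)//= ord1 expr2 lerDl.
by apply: sumr_ge0 => k _; rewrite -expr2 sqr_ge0.
Qed.

Lemma dot_gt0 x : x != 0 -> 0 < dot x x.
Proof.
by move=> x0; apply: lt_le_trans (dot_ge_norm x); rewrite exprn_gt0// normr_gt0.
Qed.

Lemma dot_lt_norm x (e : R) : 0 <= e -> dot x x < e ^+ 2 -> `|x| < e.
Proof.
move=> e0 /(le_lt_trans (dot_ge_norm x)).
by rewrite ltr_pXn2r// nnegrE.
Qed.

Lemma continuous_dot (T : topologicalType) (f g : T -> 'rV[R]_n) (a : T) :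
  {for a, continuous f} -> {for a, continuous g} ->
  {for a, continuous (fun t => dot (f t) (g t))}.
Proof.
move=> cf cg; rewrite /continuous_at /dot; apply: cvg_big => [|i _].
  exact: add_continuous.
have cont_coord (h : T -> 'rV[R]_n) : {for a, continuous h} ->
    (fun t => h t 0 i) @ a --> h a 0 i.
  move=> ch; pose k (y : 'rV[R]_n) : R := y 0 i.
  have ck : {for h a, continuous k} by exact: matrix_normedtype.coord_continuous.
  exact: (continuous_comp ch ck).
by apply: cvgM; exact: cont_coord.
Qed.

Lemma is_derive_coord x v i : is_derive x v (fun y : 'rV[R]_n => y 0 i : R) (v 0 i).
Proof.
apply: DeriveDef; first by apply: diff_derivable; exact: differentiable_coord.
have := @derive_mx R 'rV[R]_n 1 n id x v; rewrite derive_id => /(_ ltac:(exact: derivable_id)) vE.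
by rewrite [in RHS]vE mxE.
Qed.

Lemma is_derive_dot z w x v : is_derive x v (fun y => dot (y - z) w) (dot v w).
Proof.
have -> : (fun y => dot (y - z) w) =
    \sum_i (fun y : 'rV[R]_n => y 0 i * w 0 i - z 0 i * w 0 i).
  apply/funext => y; rewrite fct_sumE; apply: eq_bigr => i _.
  by rewrite !mxE mulrBl.
apply: is_derive_sum => i.
rewrite -[X in is_derive _ _ _ X]subr0; apply: is_deriveB.
have := is_deriveM (is_derive_coord x v i) (is_derive_cst (w 0 i) x v).
move/is_derive_eq; apply.
by rewrite scaler0 add0r /= /cst [LHS]mulrC.
Qed.

Lemma is_derive_dot2 z x v :
  is_derive x v (fun y => dot (y - z) (y - z)) (2 * dot (x - z) v).
Proof.
have -> : (fun y => dot (y - z) (y - z)) =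
    \sum_i (fun y : 'rV[R]_n => y 0 i - z 0 i) ^+ 2.
  apply/funext => y; rewrite fct_sumE; apply: eq_bigr => i _.
  by rewrite !mxE -expr2.
rewrite mulr_sumr; apply: is_derive_sum => i.
have := is_deriveX 2 (is_deriveB (is_derive_coord x v i) (is_derive_cst (z 0 i) x v)).
move/is_derive_eq; apply.
by rewrite /= !fctE /cst subr0 expr1 !mxE /GRing.scale /= mulrA.
Qed.

End dot.

Section barrier.
Context {R : realType} {n : nat}.
Variables (z x1 : 'rV[R]_n) (rho A : R).
Implicit Types (x v : 'rV[R]_n).

(** Put t = rho - |x - z|^2. The classical barrier exp (alpha t) - 1 is replaced by a multiple of
    its quadratic Taylor polynomial, since [A] t^2 already supplies the large term 8 A ((x - z) .
    v)^2 in [ddbarrier]. The last summand makes the barrier negative on the sphere t = 0 except at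
    x1. *)
Definition barrier x : R :=
  (rho - dot (x - z) (x - z)) + A * (rho - dot (x - z) (x - z)) ^+ 2
  - dot (x - x1) (x - x1).

Definition dbarrier v x : R :=
  - (2 * dot (x - z) v) * (1 + 2 * A * (rho - dot (x - z) (x - z)))
  - 2 * dot (x - x1) v.

Definition ddbarrier v x : R :=
  - (2 * dot v v) * (1 + 2 * A * (rho - dot (x - z) (x - z)))
  + 8 * A * dot (x - z) v ^+ 2 - 2 * dot v v.

Let t x := rho + (-1) * dot (x - z) (x - z).

Let is_derive_t x v : is_derive x v t (0 + (-1) * (2 * dot (x - z) v)).
Proof. exact: (is_deriveDZ (-1) (is_derive_cst rho x v) (is_derive_dot2 z x v)). Qed.

Lemma is_derive_barrier x v : is_derive x v barrier (dbarrier v x).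
Proof.
have -> : barrier = fun y => (t y + A * (t y * t y)) + (-1) * dot (y - x1) (y - x1).
  by apply/funext => y; rewrite /barrier /t; ring.
have H := is_deriveDZ A (is_derive_t x v) (is_deriveMr (is_derive_t x v) (is_derive_t x v)).
have := is_deriveDZ (-1) H (is_derive_dot2 x1 x v).
move/is_derive_eq; apply.
by rewrite /dbarrier /t; ring.
Qed.

Lemma is_derive_dbarrier x v : is_derive x v (dbarrier v) (ddbarrier v x).
Proof.
have -> : dbarrier v = fun y => (0 + (-2) * (dot (y - z) v * (1 + (2 * A) * t y)))
    + (-2) * dot (y - x1) v.
  by apply/funext => y; rewrite /dbarrier /t; ring.
have H1 := is_deriveDZ (2 * A) (is_derive_cst (1 : R) x v) (is_derive_t x v).
have H := is_deriveDZ (-2) (is_derive_cst (0 : R) x v) (is_deriveMr (is_derive_dot z v x v) H1).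
have := is_deriveDZ (-2) H (is_derive_dot x1 v x v).
move/is_derive_eq; apply.
by rewrite /ddbarrier /t /cst; ring.
Qed.

End barrier.

(** * The strong maximum principle *)

Section maximum_principle.
Context {R : realType} {n : nat}.
Implicit Types (f : 'rV[R]_n -> R) (x v : 'rV[R]_n) (V : set 'rV[R]_n).

Lemma compact_norm_ball x (r : R) : compact [set y | `|y - x| <= r].
Proof.
apply: bounded_closed_compact.
  exists (`|x| + r); split; first exact: num_real.
  move=> M xrM y /= yx; apply: le_trans (ltW xrM).
  have := ler_normD (y - x) x; rewrite subrK; lra.
have -> : [set y | `|y - x| <= r] = closed_ball_ Num.norm x r.
  by apply/seteqP; split => y /=; rewrite distrC.
exact: closed_closed_ball_.
Qed.

(** The directions are frozen vectors: a coefficient field enters through its value at x and is not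
    differentiated. The derivatives of [J] are collected in [b]. *)
Definition lop f v w b x : R := 'D_v ('D_v f) x + 'D_w ('D_w f) x + 'D_b f x.

Lemma near_ball_norm x y (s : R) : `|x - y| < s -> \forall x' \near x, `|x' - y| < s.
Proof.
move=> xs; apply/near_normP; exists (s - `|x - y|); first by rewrite subr_gt0.
by move=> x' x's; have := ler_normD (x' - x) (x - y); rewrite subrKA; lra.
Qed.

Lemma near_lt (T : topologicalType) (g : T -> R) (x : T) (c : R) :
  {for x, continuous g} -> g x < c -> \forall y \near x, g y < c.
Proof. by move=> cg; exact: (cvgr_lt _ cg). Qed.

Lemma near_gt (T : topologicalType) (g : T -> R) (x : T) (c : R) :
  {for x, continuous g} -> c < g x -> \forall y \near x, c < g y.
Proof. by move=> cg; exact: (cvgr_gt _ cg). Qed.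

Lemma continuous_dot2 z : continuous (fun y : 'rV[R]_n => dot (y - z) (y - z)).
Proof.
move=> x; have cx : {for x, continuous (fun y : 'rV[R]_n => y - z)}.
  by apply: continuousB => //; exact: cst_continuous.
exact: (continuous_dot cx cx).
Qed.

Lemma continuous_barrier (z x1 : 'rV[R]_n) (rho A : R) x :
  {for x, continuous (barrier z x1 rho A)}.
Proof.
rewrite /barrier.
have ct : {for x, continuous (fun y : 'rV[R]_n => rho - dot (y - z) (y - z))}.
  by apply: continuousB; [exact: cst_continuous|exact: continuous_dot2].
apply: continuousB; last exact: continuous_dot2.
apply: continuousD => //; apply: continuousM; first exact: cst_continuous.
exact: continuousM.
Qed.

Lemma lop_barrier_continuous (z x1 : 'rV[R]_n) (rho A : R) v
    (Y B : 'rV[R]_n -> 'rV[R]_n) x :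
  {for x, continuous Y} -> {for x, continuous B} ->
  {for x, continuous (fun y => ddbarrier z rho A v y + ddbarrier z rho A (Y y) y
     + dbarrier z x1 rho A (B y) y)}.
Proof.
move=> cY cB.
have cid (c : 'rV[R]_n) : {for x, continuous (fun y : 'rV[R]_n => y - c)}.
  by apply: continuousB => //; exact: cst_continuous.
have cv : {for x, continuous (fun _ : 'rV[R]_n => v)} by exact: cst_continuous.
have ct : {for x, continuous (fun y : 'rV[R]_n => 1 + 2 * A * (rho - dot (y - z) (y - z)) : R)}.
  apply: continuousD; first exact: cst_continuous.
  apply: continuousM; first exact: cst_continuous.
  by apply: continuousB; [exact: cst_continuous|exact: continuous_dot].
have cdd (W : 'rV[R]_n -> 'rV[R]_n) : {for x, continuous W} ->
    {for x, continuous (fun y => ddbarrier z rho A (W y) y)}.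
  move=> cW; rewrite /ddbarrier.
  have cWW : {for x, continuous (fun y => 2 * dot (W y) (W y))}.
    by apply: continuousM; [exact: cst_continuous|exact: continuous_dot].
  apply: continuousB => //; apply: continuousD.
    by apply: continuousM => //; exact: continuousN.
  apply: continuousM; first exact: cst_continuous.
  by apply: continuousM; exact: continuous_dot.
apply: continuousD; first by apply: continuousD; exact: cdd.
apply: continuousB.
  apply: continuousM => //; apply: continuousN; apply: continuousM; first exact: cst_continuous.
  exact: continuous_dot.
by apply: continuousM; [exact: cst_continuous|exact: continuous_dot].
Qed.

(** The operator contains only pure second derivatives, so one-dimensional calculus in the
    directions v, w and b suffices; no Hessian is formed. *)
Lemma lop_le0_at_max f (z x1 : 'rV[R]_n) (rho A e : R) v w b x :
  (\forall y \near x, differentiable f y) ->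
  (forall v, differentiable ('D_v f) x) ->
  (\forall y \near x, f y + e * barrier z x1 rho A y <= f x + e * barrier z x1 rho A x) ->
  lop f v w b x + e * (ddbarrier z rho A v x + ddbarrier z rho A w x
    + dbarrier z x1 rho A b x) <= 0.
Proof.
move=> df ddf xmax.
have step u : 'D_u f x + e * dbarrier z x1 rho A u x = 0 /\
    'D_u ('D_u f) x + e * ddbarrier z rho A u x <= 0.
  apply: (@derive2_local_max _ _ (fun y => f y + e * barrier z x1 rho A y)
    (fun y => 'D_u f y + e * dbarrier z x1 rho A u y) x u) => //.
    apply: filterS df => y dfy; apply: is_deriveDZ (is_derive_barrier z x1 rho A y u).
    by apply: derivableP; exact: diff_derivable.
  apply: is_deriveDZ (is_derive_dbarrier z x1 rho A x u).
  by apply: derivableP; exact: diff_derivable.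
have [_ sv] := step v; have [_ sw] := step w; have [sb _] := step b.
move: sv sw sb; rewrite /lop.
move: ('D_v _ _) ('D_w _ _) ('D_b _ _) (ddbarrier _ _ _ v _) (ddbarrier _ _ _ w _) (dbarrier _ _ _ _ _ _).
by clear; move=> a a' a'' b b' b'' sv sw sb; rewrite !mulrDr; lra.
Qed.

(* On the sphere either h < 0 or, by compactness, f stays away from its maximum, so for
   small e the function f + e * h is smaller there than at x1. *)
Lemma interior_max_of_barrier f (h : 'rV[R]_n -> R) x1 (s : R) : 0 < s ->
  (forall x, `|x - x1| <= s -> {for x, continuous f}) ->
  (forall x, {for x, continuous h}) ->
  (forall x, `|x - x1| <= s -> f x <= f x1) ->
  (forall x, `|x - x1| = s -> 0 <= h x -> f x < f x1) -> h x1 = 0 ->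
  exists e x, [/\ 0 < e, `|x - x1| < s &
    forall y, `|y - x1| <= s -> f y + e * h y <= f x + e * h x].
Proof.
move=> s0 cf ch fmax fsphere hx1; apply: contrapT => noint.
pose C := [set y | `|y - x1| <= s].
have cC : compact C by exact: compact_norm_ball.
have Cx1 : C x1 by rewrite /C /= subrr normr0 ltW.
(* By contradiction: for every e > 0 a maximum over the ball is attained, and it must lie on the
   bounding sphere. *)
have max_sphere (e : R) : 0 < e -> exists x, [/\ C x, `|x - x1| = s &
    f x1 <= f x + e * h x].
  move=> e0; have [|Q] := @EVT_max_rV R n (fun x => f x + e * h x) C (ex_intro _ x1 Cx1) cC.
    apply: continuous_in_subspaceT => x; rewrite inE => Cx.
    have ceh : {for x, continuous (fun x => e * h x)}.
      by apply: continuousM; [exact: cst_continuous|exact: ch].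
    exact: (continuousD (cf _ Cx) ceh).
  rewrite inE => CQ Qmax; exists Q; split=> //; last first.
    by have := Qmax x1; rewrite inE => /(_ Cx1); rewrite hx1 mulr0 addr0.
  apply/eqP; rewrite eq_le CQ /= leNgt; apply/negP => Qs.
  by apply: noint; exists e, Q; split=> // y ys; apply: Qmax; rewrite inE.
pose S := C `&` [set x | `|x - x1| = s /\ 0 <= h x].
have cS : compact S.
  apply: compact_subset_near => // x Cx nP.
  have [hx|hx] := ltP (h x) 0.
    by apply: filterS (near_lt (ch x) hx) => y hy [_]; rewrite leNgt hy.
  have xs : `|x - x1| < s.
    by rewrite lt_neqAle andbC; apply/andP; split=> //; apply/eqP => xs; exact: nP.
  by apply: filterS (near_ball_norm xs) => y ys [ys']; rewrite ys' ltxx in ys.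
have sphS (e : R) x : 0 < e -> C x -> `|x - x1| = s -> f x1 <= f x + e * h x -> S x.
  move=> e0 Cx xs le; split=> //; split=> //.
  by rewrite -(pmulr_rge0 _ e0) -(lerD2l (f x)) addr0 (le_trans _ le)// fmax.
(* The choice e = 1 only shows that [S] is nonempty, so that f attains a maximum on it. *)
have [Q1 [CQ1 Q1s Q1h]] := max_sphere 1 ltr01.
have [|Q0] := @EVT_max_rV R n f S (ex_intro _ Q1 (sphS _ _ ltr01 CQ1 Q1s Q1h)) cS.
  by apply: continuous_in_subspaceT => x; rewrite inE => -[Cx _]; exact: cf.
rewrite inE => -[_ [Q0s hQ0]] Q0max; have fQ0 := fsphere _ Q0s hQ0.
have [|H] := @EVT_max_rV R n h C (ex_intro _ x1 Cx1) cC.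
  by apply: continuous_in_subspaceT => x _; exact: ch.
rewrite inE => CH Hmax.
have hH : 0 <= h H by rewrite -hx1; apply: Hmax; rewrite inE.
(* Chosen so that e h < f x1 - f Q0 on the ball, which keeps f + e h below f x1 on [S]. The [+ 1]
   covers a zero maximum of h. *)
pose e := (f x1 - f Q0) / (h H + 1).
have h1 : 0 < h H + 1 by rewrite ltr_wpDl.
have e0 : 0 < e by rewrite divr_gt0// subr_gt0.
have [Q [CQ Qs Qh]] := max_sphere e e0.
have := Q0max Q; rewrite inE => /(_ (sphS _ _ e0 CQ Qs Qh)) fQ.
have := Hmax Q; rewrite inE => /(_ CQ) hQ.
have eh : e * h Q < f x1 - f Q0.
  apply: le_lt_trans (_ : e * h H < _); first by rewrite ler_wpM2l// ltW.
  by rewrite /e mulrAC ltr_pdivrMr// ltr_pM2l ?subr_gt0// ltrDl ltr01.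
have := le_lt_trans Qh (ler_ltD fQ eh).
by rewrite addrC subrK ltxx.
Qed.

(* Hopf's argument: x1 lies on the sphere of center z, inside of which f < f x1. *)
Lemma no_touching_sphere f (V : set 'rV[R]_n) z x1 (Y B : 'rV[R]_n -> 'rV[R]_n) :
  open V -> V x1 -> x1 != z ->
  (forall x, V x -> differentiable f x) ->
  (forall v x, V x -> differentiable ('D_v f) x) ->
  (forall x, V x -> [/\ {for x, continuous Y}, {for x, continuous B}
     & lop f (x1 - z) (Y x) (B x) x = 0]) ->
  (forall x, V x -> f x <= f x1) ->
  ~ (forall x, V x -> dot (x - z) (x - z) < dot (x1 - z) (x1 - z) -> f x < f x1).
Proof.
move=> oV Vx1 x1z df ddf YB fmax Kin.
set v := x1 - z in YB Kin.
have v0 : 0 < dot v v by apply: dot_gt0; rewrite subr_eq0.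
pose rho := dot v v.
(* At x1 the operator applied to the barrier is at least 8 A |v|^4 minus the left-hand side; the
   term 8 A (v . Y)^2 has the good sign because A >= 0. That v is the normal x1 - z is what makes
   the coefficient of A nonzero. *)
have [A A0 cA] : exists2 A : R, 0 <= A &
    4 * dot v v + 4 * dot (Y x1) (Y x1) + 2 * dot v (B x1) < 8 * A * dot v v ^+ 2.
  set c : R := _ + _; exists ((`|c| + 1) / (8 * dot v v ^+ 2)).
    by rewrite divr_ge0// ?addr_ge0// mulr_ge0// exprn_ge0// ltW.
  rewrite mulrAC mulrC divfK ?mulf_neq0 ?expf_neq0 ?gt_eqF//.
  by rewrite (le_lt_trans (ler_norm c))// ltrDl.
pose l x := ddbarrier z rho A v x + ddbarrier z rho A (Y x) x + dbarrier z x1 rho A (B x) x.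
have lx1 : 0 < l x1.
  have := mulr_ge0 (mulr_ge0 (ler0n R 8) A0) (sqr_ge0 (dot v (Y x1))).
  rewrite /l /ddbarrier /dbarrier /rho -/v !subrr mulr0 addr0 !mulr1 dot0l mulr0 subr0.
  move: cA; move: (8 * A * dot v v ^+ 2) (dot v v) (dot (Y x1) (Y x1)) (dot v (B x1)) (_ * _ ^+ 2).
  by clear; move=> a b c d p; lra.
have [cY cB _] := YB _ Vx1.
have [d d0 Hd] : exists2 d : R, 0 < d & forall y, `|y - x1| < d ->
    [/\ V y, 0 < l y & 0 < 1 + A * (rho - dot (y - z) (y - z))].
  apply/near_normP.
  have n1 : \forall y \near x1, 0 < l y.
    by apply: (near_gt (lop_barrier_continuous cY cB)).
  have n2 : \forall y \near x1, V y by exact: open_nbhs_nbhs.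
  have n3 : \forall y \near x1, 0 < 1 + A * (rho - dot (y - z) (y - z)).
    have c3 : {for x1, continuous (fun y : 'rV[R]_n => 1 + A * (rho - dot (y - z) (y - z)) : R)}.
      apply: continuousD; first exact: cst_continuous.
      apply: continuousM; first exact: cst_continuous.
      by apply: continuousB; [exact: cst_continuous|exact: continuous_dot2].
    by apply: (near_gt c3); rewrite subrr mulr0 addr0.
  by near do split.
have d20 : 0 < d / 2 by rewrite divr_gt0.
have Hs y : `|y - x1| <= d / 2 -> [/\ V y, 0 < l y & 0 < 1 + A * (rho - dot (y - z) (y - z))].
  move=> yd; apply: Hd; apply: le_lt_trans yd _.
  by rewrite ltr_pdivrMr// ltr_pMr// ltr1n.
have [||||||e [Q [e0 Qs Qmax]]] := @interior_max_of_barrier f (barrier z x1 rho A) x1 (d / 2).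
- by [].
- by move=> x /Hs[Vx _ _]; apply: differentiable_continuous; exact: df.
- by move=> x; exact: continuous_barrier.
- by move=> x /Hs[Vx _ _]; exact: fmax.
(* With t = rho - |x - z|^2, the bound 0 <= h x reads t (1 + A t) >= |x - x1|^2 > 0. Since 1 + A t >
   0 near x1, this gives t > 0: x lies strictly inside the touching sphere. *)
- move=> x xs hx; have [|Vx _ Ax] := Hs x; first by rewrite xs.
  apply: Kin => //; rewrite -subr_gt0 -(pmulr_lgt0 _ Ax).
  have : 0 < dot (x - x1) (x - x1) by apply: dot_gt0; rewrite -normr_gt0 xs.
  move: hx; rewrite /barrier -/rho; move: (_ - dot (x - z) _) (dot (x - x1) _).
  by clear; move=> a b; rewrite expr2; lra.
- by rewrite /barrier !subrr dot0l expr0n/= mulr0 addr0 subr0.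
have [VQ lQ _] := Hs _ (ltW Qs); have [_ _ fQ] := YB Q VQ.
suff : lop f v (Y Q) (B Q) Q + e * l Q <= 0.
  by rewrite fQ add0r leNgt mulr_gt0.
apply: lop_le0_at_max.
- by apply: filterS (open_nbhs_nbhs (conj oV VQ)) => y Vy; exact: df.
- by move=> u; exact: ddf.
- by apply: filterS (near_ball_norm Qs) => y /ltW; exact: Qmax.
Unshelve. all: by end_near. Qed.

(** Otherwise pick z near x0 off the level set of the maximum, and a point x1 of the level set
    nearest to z. The open Euclidean ball about z through x1 misses the level set, which
    [no_touching_sphere] forbids. The coefficients are requested from the hypothesis only once v =
    x1 - z is known. *)
Lemma strong_max_principle f (V : set 'rV[R]_n) x0 :
  open V -> V x0 ->
  (forall x, V x -> differentiable f x) ->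
  (forall v x, V x -> differentiable ('D_v f) x) ->
  (forall v, exists Y B : 'rV[R]_n -> 'rV[R]_n, forall x, V x ->
     [/\ {for x, continuous Y}, {for x, continuous B} & lop f v (Y x) (B x) x = 0]) ->
  (forall x, V x -> f x <= f x0) ->
  \forall x \near x0, f x = f x0.
Proof.
move=> oV Vx0 df ddf ell fmax; apply: contrapT => nfx0.
have cf x : V x -> {for x, continuous f} by move=> /df; exact: differentiable_continuous.
have [r r_gt0 rV] : exists2 r : R, 0 < r & forall y, `|y - x0| <= r -> V y.
  have /near_normP[d d0 dV] : \forall y \near x0, V y by exact: open_nbhs_nbhs.
  exists (d / 2); first by rewrite divr_gt0.
  move=> y yd; apply: dV; apply: le_lt_trans yd _.
  by rewrite ltr_pdivrMr// ltr_pMr// ltr1n.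
(* Both |z - x0| and |x1 - z| stay below r / 2, so the touching ball remains within r of x0, hence
   in [V]. *)
have r20 : 0 < r / 2 by rewrite divr_gt0.
have [z zr fz] : exists2 z, dot (z - x0) (z - x0) < (r / 2) ^+ 2 & f z <> f x0.
  apply: contrapT => H; apply: nfx0.
  have : \forall y \near x0, dot (y - x0) (y - x0) < (r / 2) ^+ 2.
    by apply: (near_lt (@continuous_dot2 x0 x0)); rewrite subrr dot0l exprn_gt0.
  by apply: filterS => y yr; apply: contrapT => fy; apply: H; exists y.
pose q x := dot (x - z) (x - z).
pose K := [set y | `|y - x0| <= r] `&` [set y | f y = f x0].
have cK : compact K.
  apply: compact_subset_near; first exact: compact_norm_ball.
  move=> x /rV Vx /eqP nfx.
  have : \forall y \near x, f y != f x0.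
    have [fx|fx] := ltP (f x) (f x0).
      by apply: filterS (near_lt (cf _ Vx) fx) => y; rewrite lt_neqAle => /andP[].
    have {}fx : f x0 < f x by rewrite lt_neqAle eq_sym nfx.
    by apply: filterS (near_gt (cf _ Vx) fx) => y; rewrite lt_neqAle eq_sym => /andP[].
  by apply: filterS => y /eqP.
have Kx0 : K x0 by split=> //=; rewrite subrr normr0 ltW.
have [|x1] := @EVT_min_rV R n q K (ex_intro _ x0 Kx0) cK.
  by apply: continuous_in_subspaceT => x _; exact: continuous_dot2.
rewrite inE => -[/= x1r fx1] x1min.
have qx01 : q x1 < (r / 2) ^+ 2.
  apply: le_lt_trans (x1min x0 _) _; first by rewrite inE.
  by rewrite /q -dotNN opprB.
have inner x : q x < (r / 2) ^+ 2 -> `|x - x0| <= r.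
  move=> /(dot_lt_norm (ltW r20)) h1; have h2 := dot_lt_norm (ltW r20) zr.
  by rewrite -(subrKA z) (le_trans (ler_normD _ _))// [leRHS]splitr lerD// ltW.
have [Y [B YB]] := ell (x1 - z).
apply: (@no_touching_sphere f V z x1 Y B) => //; first exact: rV.
- by apply/eqP => x1z; apply: fz; rewrite -x1z.
- by rewrite fx1.
- move=> x Vx qx; rewrite fx1 lt_neqAle fmax ?andbT//.
  apply/eqP => fx; move: (qx); apply/negP; rewrite -leNgt.
  apply: x1min; rewrite inE; split=> //; apply: inner; exact: lt_trans qx qx01.
Qed.

End maximum_principle.

(** * The second-order equation in coordinates *)

Section coordinates.
Context {R : realType} {n : nat}.

Lemma derive_delta (W : normedModType R) (f : 'rV[R]_n -> W) x v : differentiable f x ->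
  'D_v f x = \sum_k v 0 k *: 'D_(delta_mx 0 k) f x.
Proof.
move=> df; rewrite deriveE// {1}(row_sum_delta v) linear_sum.
by apply: eq_bigr => k _; rewrite linearZ deriveE.
Qed.

Lemma continuous_rV (T : topologicalType) (f : T -> 'rV[R]_n) x :
  (forall j, {for x, continuous (fun y => f y 0 j)}) -> {for x, continuous f}.
Proof.
move=> cf; apply/cvgrPdist_le => /= e e0; near=> y.
rewrite /Num.Def.normr/= mx_normrE (bigmax_le _ (ltW e0))//= => -[i j] _.
rewrite !mxE/= ord1; move: j; near: y; apply: filter_forall => j.
exact: ((cvgrPdist_le _ _).1 (cf j)).
Unshelve. all: by end_near. Qed.

Lemma continuous_entry (T : topologicalType) m p (f : T -> 'M[R]_(m, p)) x i j :
  {for x, continuous f} -> {for x, continuous (fun y => f y i j)}.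
Proof.
move=> cf; pose k (A : 'M[R]_(m, p)) : R := A i j.
have ck : {for f x, continuous k} by exact: matrix_normedtype.coord_continuous.
exact: (continuous_comp cf ck).
Qed.

Lemma continuous_sumr (T : topologicalType) p (F : 'I_p -> T -> R) x :
  (forall i, {for x, continuous (F i)}) -> {for x, continuous (fun y => \sum_i F i y)}.
Proof.
move=> cF; rewrite /continuous_at; apply: cvg_big => [|i _].
  exact: add_continuous.
exact: cF.
Qed.

Lemma continuous_mulmx (T : topologicalType) m (f : T -> 'rV[R]_m) (g : T -> 'M[R]_(m, n)) x :
  {for x, continuous f} -> {for x, continuous g} ->
  {for x, continuous (fun y => f y *m g y)}.
Proof.
move=> cf cg; apply: continuous_rV => j.
have -> : (fun y => (f y *m g y) 0 j) = (fun y => \sum_i f y 0 i * g y i j).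
  by apply/funext => y; rewrite mxE.
apply: continuous_sumr => i.
by apply: (continuousM (continuous_entry (i := 0) (j := i) cf) (continuous_entry (i := i) (j := j) cg)).
Qed.

Lemma is_derive_sumr (V : normedModType R) p (F : 'I_p -> V -> R) (dF : 'I_p -> R) x v :
  (forall i, is_derive x v (F i) (dF i)) ->
  is_derive x v (fun y => \sum_i F i y) (\sum_i dF i).
Proof.
move=> dFi; rewrite [X in is_derive _ _ X _](_ : _ = \sum_i F i).
  exact: is_derive_sum.
by apply/funext => y; rewrite fct_sumE.
Qed.

Lemma is_derive_mulmx (V : normedModType R) m (w : 'rV[R]_m) (J : V -> 'M[R]_(m, n)) x v k :
  derivable J x v ->
  is_derive x v (fun y => (w *m J y) 0 k) ((w *m 'D_v J x) 0 k).
Proof.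
move=> dJ; have -> : (fun y => (w *m J y) 0 k) = fun y => \sum_i w 0 i * J y i k.
  by apply/funext => y; rewrite mxE.
rewrite mxE; apply: is_derive_sumr => i.
apply: (is_deriveZ (w 0 i)).
rewrite derive_mx// mxE; apply: derivableP.
exact: (derivable_mxP _ _ _).1.
Qed.

Section first_order.
Variables (a : 'rV[R]_n -> R) (x : 'rV[R]_n).
Hypothesis da : \forall y \near x, differentiable a y.
Hypothesis dda : forall v, differentiable ('D_v a) x.

Lemma derive_delta2 v w :
  'D_v ('D_w a) x = \sum_k w 0 k * 'D_v ('D_(delta_mx 0 k) a) x.
Proof.
rewrite (near_eq_derive (g := fun y => \sum_k w 0 k * 'D_(delta_mx 0 k) a y)).
  have dk k : is_derive x v (fun y => w 0 k * 'D_(delta_mx 0 k) a y)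
      (w 0 k * 'D_v ('D_(delta_mx 0 k) a) x).
    by apply: (is_deriveZ (w 0 k)); apply: derivableP; exact: diff_derivable.
  by have [_ ->] := is_derive_sumr dk.
by apply: filterS da => y day; rewrite derive_delta.
Qed.

(** A product rule: the direction moves with y as well. The first summand, due to that motion, is
    the source of the first-order terms of the equation. *)
Lemma is_derive_moving_dir m (w : 'rV[R]_m) (J : 'rV[R]_n -> 'M[R]_(m, n)) v :
  derivable J x v ->
  is_derive x v (fun y => 'D_(w *m J y) a y)
    ('D_(w *m 'D_v J x) a x + 'D_v ('D_(w *m J x) a) x).
Proof.
move=> dJ; apply: (near_eq_is_derive (f := fun y => \sum_k (w *m J y) 0 k * 'D_(delta_mx 0 k) a y)).
  by apply: filterS da => y day; rewrite [in RHS]derive_delta.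
rewrite derive_delta2 derive_delta; last exact: nbhs_singleton da.
rewrite -big_split /=; apply: is_derive_sumr => k; apply: is_deriveMr.
  exact: is_derive_mulmx.
by apply: derivableP; exact: diff_derivable.
Qed.

End first_order.

Lemma linear_on_rows (phi : 'rV[R]_n -> R) p (w : 'rV[R]_p) (M : 'M[R]_(p, n)) :
  (forall c, phi c = \sum_k c 0 k * phi (delta_mx 0 k)) ->
  phi (w *m M) = \sum_j w 0 j * phi (row j M).
Proof.
move=> lin; rewrite lin; under [RHS]eq_bigr => j _ do rewrite lin mulr_sumr.
rewrite exchange_big; apply: eq_bigr => k _; rewrite mxE mulr_suml.
by apply: eq_bigr => j _; rewrite mxE mulrA.
Qed.

Lemma is_derive_dir_row (a : 'rV[R]_n -> R) (J : 'rV[R]_n -> 'M[R]_n) x u j :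
  (\forall y \near x, differentiable a y) -> (forall w, differentiable ('D_w a) x) ->
  differentiable J x ->
  is_derive x u (fun y => 'D_(row j (J y)) a y)
    ('D_(row j ('D_u J x)) a x + 'D_u ('D_(row j (J x)) a) x).
Proof.
move=> da dda dJ; under eq_fun do rewrite rowE.
rewrite !rowE; apply: is_derive_moving_dir => //; exact: diff_derivable.
Qed.

(** Here theta is the 1-form db + J^* da, and the hypothesis is dtheta (v, Jv) = 0 at x. The b terms
    cancel by symmetry of second derivatives, and J^2 = -1 turns D_v D_{Jw} a into - D_v D_v a. *)
Lemma lop_eq0 (a b : 'rV[R]_n -> R) (J : 'rV[R]_n -> 'M[R]_n) x v :
  (\forall y \near x, differentiable a y) ->
  (\forall y \near x, differentiable b y) ->
  (forall u, differentiable ('D_u a) x) -> (forall u, differentiable ('D_u b) x) ->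
  differentiable J x -> J x *m J x = - 1%:M ->
  let w := v *m J x in
  let theta j y := 'D_(delta_mx 0 j) b y + 'D_(row j (J y)) a y in
  \sum_i \sum_j v 0 i * w 0 j *
    ('D_(delta_mx 0 i) (theta j) x - 'D_(delta_mx 0 j) (theta i) x) = 0 ->
  lop a v w (v *m 'D_w J x - w *m 'D_v J x) x = 0.
Proof.
have aux (p q r s t : R) : p + (t - q) - (p + (s + r)) = 0 -> q + r + (s - t) = 0.
  by lra.
move=> da db dda ddb dJ JJ w theta.
have dax := nbhs_singleton da.
(* The derivative along u of theta on the constant vector c, so that dtheta (v, w) = T v w - T w v
   with w frozen at its value v J(x). *)
pose T (u c : 'rV[R]_n) : R := 'D_u ('D_c b) x + ('D_(c *m 'D_u J x) a x + 'D_u ('D_(c *m J x) a) x).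
have dtheta (u : 'rV[R]_n) j : 'D_u (theta j) x = T u (delta_mx 0 j).
  have d1 : is_derive x u ('D_(delta_mx 0 j) b) ('D_u ('D_(delta_mx 0 j) b) x).
    by apply: derivableP; exact: diff_derivable.
  have d2 := is_derive_dir_row u j da dda dJ.
  by have [_ ->] := is_deriveD d1 d2; rewrite !rowE.
have lina (c : 'rV[R]_n) : 'D_c a x = \sum_k c 0 k * 'D_(delta_mx 0 k) a x by rewrite derive_delta.
have linTr (u c : 'rV[R]_n) : \sum_j c 0 j * T u (delta_mx 0 j) = T u c.
  rewrite /T [in RHS](@derive_delta2 b)// (linear_on_rows _ _ lina).
  rewrite (linear_on_rows (phi := fun c => 'D_u ('D_c a) x)); last exact: derive_delta2.
  rewrite -!big_split; apply: eq_bigr => j _ /=.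
  by rewrite -!rowE !mulrDr.
have linTl (u c : 'rV[R]_n) : \sum_i u 0 i * T (delta_mx 0 i) c = T u c.
  rewrite /T [in RHS]derive_delta// [in X in _ = _ + (_ + X)]derive_delta//.
  have -> : c *m 'D_u J x = u *m \matrix_i (c *m 'D_(delta_mx 0 i) J x).
    rewrite derive_delta// mulmx_sumr mulmx_sum_row.
    by apply: eq_bigr => i _; rewrite rowK scalemxAr.
  rewrite (linear_on_rows _ _ lina) -!big_split; apply: eq_bigr => i _ /=.
  by rewrite rowK !mulrDr.
have -> : \sum_i \sum_j v 0 i * w 0 j *
    ('D_(delta_mx 0 i) (theta j) x - 'D_(delta_mx 0 j) (theta i) x) = T v w - T w v.
  rewrite -[T v w]linTl -[T w v]linTr -sumrB; apply: eq_bigr => i _.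
  rewrite -[T _ w]linTr -[T w _]linTl -mulrBr -sumrB mulr_sumr; apply: eq_bigr => j _.
  by rewrite !dtheta -mulrA mulrBr.
have wJ : w *m J x = - v by rewrite /w -mulmxA JJ mulmxN mulmx1.
have Dvv : 'D_v ('D_(- v) a) x = - 'D_v ('D_v a) x.
  rewrite (derive_delta2 da)// [in RHS](derive_delta2 da)// -sumrN.
  by apply: eq_bigr => k _; rewrite mxE mulNr.
rewrite /T wJ -/w Dvv (derive_comm db (ddb v) (ddb w)) /lop.
rewrite deriveD_dir// (deriveN_dir _ dax).
exact: aux.
Qed.

End coordinates.

(** * Complex-valued forms *)

Section complex_forms.
Context {R : realType} {n : nat}.
Implicit Types (J : 'M[R]_n) (B : 'M[R[i]]_n).

Lemma cmxM m p q (A : 'M[R]_(m, p)) (B : 'M[R]_(p, q)) : cmx (A *m B) = cmx A *m cmx B.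
Proof. exact: map_mxM. Qed.

(** The terms in i cancel, leaving the average of the form and its pullback by [J]. *)
Lemma part11E J B :
  part11 J B = 2^-1 *: (B + cmx J *m B *m (cmx J)^T).
Proof.
rewrite /part11 /proj10 /proj01; set A := cmx J; set X := 'i *: A.
have XX : X *m B *m X^T = - (A *m B *m A^T).
  by rewrite /X linearZ /= -!scalemxAl -scalemxAr scalerA -expr2 sqrCi scaleN1r.
have trP : (2^-1 *: (1%:M + X))^T = 2^-1 *: (1%:M + X^T) by rewrite linearZ linearD /= trmx1.
have trM : (2^-1 *: (1%:M - X))^T = 2^-1 *: (1%:M - X^T) by rewrite linearZ linearB /= trmx1.
rewrite trP trM -!(scalemxAl, scalemxAr) -!scalerDr; congr (_ *: _).
rewrite !(mulmxBl, mulmxDl, mulmxBr, mulmxDr) !mul1mx !mulmx1 XX.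
have aux (P Q S : 'M[R[i]]_n) :
    B - P + (Q - - S) + (B + P - (Q + - S)) = 2 *: (B + S).
  by apply/matrixP => i j; rewrite !mxE; ring.
by rewrite aux scalerA mulVf ?scale1r// pnatr_eq0.
Qed.

Lemma part11ZB J (k : R[i]) A B :
  part11 J (k *: (A - B)) = k *: (part11 J A - part11 J B).
Proof.
rewrite /part11; move: (proj10 J) (proj01 J) => P Q.
by rewrite -!(scalemxAl, scalemxAr) -scalerDr !mulmxBr !mulmxBl opprD addrACA.
Qed.

(* On real tangent vectors the pairs (v, J v) only see the (1,1)-part of a 2-form. *)
Lemma part11_pairing J B (v : 'rV[R[i]]_n) : J *m J = - 1%:M -> B^T = - B ->
  v *m part11 J B *m (v *m cmx J)^T = v *m B *m (v *m cmx J)^T.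
Proof.
move=> JJ Balt; rewrite part11E -scalemxAr -scalemxAl mulmxDr mulmxDl.
set A := cmx J; set w := v *m A.
have AA : A *m A = - 1%:M by rewrite -cmxM JJ /cmx map_mxN map_scalar_mx rmorph1.
(* The pullback evaluates the form on (J v, - v), where an alternating form takes the same value as
   on (v, J v). *)
have -> : v *m (A *m B *m A^T) *m w^T = v *m B *m w^T.
  have wA : w *m A = - v by rewrite /w -mulmxA AA mulmxN mulmx1.
  rewrite !mulmxA -/w -mulmxA -trmx_mul wA.
  have tr1 (C : 'M[R[i]]_1) : C = C^T by apply/matrixP => i j; rewrite mxE !ord1.
  by rewrite [LHS]tr1 !trmx_mul trmxK Balt !(mulmxN, mulNmx) opprK mulmxA.
by rewrite scalerDr -scalerDl -[2^-1]mul1r -splitr scale1r.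
Qed.

Lemma ReD (x y : R[i]) : complex.Re (x + y) = complex.Re x + complex.Re y.
Proof. by case: x; case: y. Qed.

Lemma ImD (x y : R[i]) : complex.Im (x + y) = complex.Im x + complex.Im y.
Proof. by case: x; case: y. Qed.

Lemma Im_sum (I : finType) (F : I -> R[i]) :
  complex.Im (\sum_i F i) = \sum_i complex.Im (F i).
Proof. exact: (big_morph _ ImD). Qed.

Lemma Im_rmul (r : R) (z : R[i]) : complex.Im (real_complex R r * z) = r * complex.Im z.
Proof. by case: z => a b; rewrite /= mul0r addr0. Qed.

Lemma Im_pairing (v w : 'rV[R]_n) B :
  complex.Im ((cmx v *m B *m (cmx w)^T) 0 0) =
  \sum_i \sum_j v 0 i * w 0 j * complex.Im (B i j).
Proof.
rewrite mxE exchange_big /= Im_sum; apply: eq_bigr => j _.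
rewrite !mxE mulr_suml Im_sum; apply: eq_bigr => i _.
by rewrite !mxE mulrC mulrA -rmorphM Im_rmul [w 0 j * _]mulrC.
Qed.

(** ['D_(row j J)] applied to Re u is the j-th component of J^* d (Re u). The other summand is
    exact, so Im u disappears after one more exterior derivative. *)
Lemma Im_part01 J (u : 'rV[R]_n -> R[i]) x j :
  differentiable (fun y => complex.Re (u y)) x ->
  complex.Im (part01 J (d0 u x) j 0) = 2^-1 *
    ('D_(delta_mx 0 j) (fun y => complex.Im (u y)) x
     + 'D_(row j J) (fun y => complex.Re (u y)) x).
Proof.
move=> da; rewrite /part01 /proj01 -scalemxAl mxE.
have -> : 2^-1 = real_complex R 2^-1 :> R[i] by rewrite fmorphV rmorph_nat.
rewrite Im_rmul; congr (_ * _).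
rewrite mulmxDl mul1mx -scalemxAl mxE ImD; congr (_ + _); first by rewrite mxE.
rewrite mxE mxE mulr_sumr Im_sum derive_delta//.
apply: eq_bigr => k _; rewrite !mxE.
by rewrite /GRing.scale /= !(mul0r, mul1r, sub0r, add0r, addr0, subr0, oppr0, mulr0).
Qed.

Lemma Re_sum (I : finType) (F : I -> R[i]) :
  complex.Re (\sum_i F i) = \sum_i complex.Re (F i).
Proof. exact: (big_morph _ ReD). Qed.

Lemma Re_rmul (r : R) (z : R[i]) : complex.Re (real_complex R r * z) = r * complex.Re z.
Proof. by case: z => a b; rewrite /= mul0r subr0. Qed.

Lemma Re_part01 J (u : 'rV[R]_n -> R[i]) x j :
  differentiable (fun y => complex.Im (u y)) x ->
  complex.Re (part01 J (d0 u x) j 0) = 2^-1 *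
    ('D_(delta_mx 0 j) (fun y => complex.Re (u y)) x
     + -1 * 'D_(row j J) (fun y => complex.Im (u y)) x).
Proof.
move=> db; rewrite /part01 /proj01 -scalemxAl mxE.
have -> : 2^-1 = real_complex R 2^-1 :> R[i] by rewrite fmorphV rmorph_nat.
rewrite Re_rmul; congr (_ * _).
rewrite mulmxDl mul1mx -scalemxAl mxE ReD; congr (_ + _); first by rewrite mxE.
rewrite mxE mxE mulr_sumr Re_sum derive_delta// mulr_sumr.
apply: eq_bigr => k _; rewrite !mxE.
by rewrite /GRing.scale /= !(mul0r, mul1r, sub0r, add0r, addr0, subr0, oppr0, mulr0, mulN1r).
Qed.

Lemma cderiveZB (k : R[i]) (f g : 'rV[R]_n -> R[i]) x v :
  derivable (fun y => complex.Re (f y)) x v -> derivable (fun y => complex.Im (f y)) x v ->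
  derivable (fun y => complex.Re (g y)) x v -> derivable (fun y => complex.Im (g y)) x v ->
  cderive v (fun y => k * (f y - g y)) x = k * (cderive v f x - cderive v g x).
Proof.
move=> /derivableP dRf /derivableP dIf /derivableP dRg /derivableP dIg.
have dB := is_deriveDZ (-1) dRf dRg; have dB' := is_deriveDZ (-1) dIf dIg.
have d0 := is_derive_cst (0 : R) x v; case: k => kr ki; rewrite /cderive.
have -> : (fun y => complex.Re ((kr +i* ki) * (f y - g y))) = fun y =>
    (0 + kr * (complex.Re (f y) + -1 * complex.Re (g y)))
    + - ki * (complex.Im (f y) + -1 * complex.Im (g y)).
  by apply/funext => y; case: (f y) (g y) => [a b] [c d] /=; ring.
have -> : (fun y => complex.Im ((kr +i* ki) * (f y - g y))) = fun y =>
    (0 + kr * (complex.Im (f y) + -1 * complex.Im (g y)))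
    + ki * (complex.Re (f y) + -1 * complex.Re (g y)).
  by apply/funext => y; case: (f y) (g y) => [a b] [c d] /=; ring.
have [_ ->] := is_deriveDZ (- ki) (is_deriveDZ kr d0 dB) dB'.
have [_ ->] := is_deriveDZ ki (is_deriveDZ kr d0 dB') dB.
by apply/eqP; rewrite eq_complex /=; apply/andP; split; apply/eqP; ring.
Qed.

End complex_forms.

Lemma near_eq_differentiable {R : realType} {V W : normedModType R} (f g : V -> W) x :
  (\forall y \near x, f y = g y) -> differentiable f x -> differentiable g x.
Proof.
move=> fg df; have [dfc dfo] := (diff_locallyP _ _).1 df.
have go : g \o shift x = cst (g x) + 'd f x +o_ 0 id.
  apply/eqaddoP => e e0.
  have := (eqaddoP _ _ _ _).1 dfo e e0.
  have nfg : \forall h \near (0 : V), f (h + x) = g (h + x).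
    have /near_normP[d d0 dP] := fg.
    by apply/near_normP; exists d => // h; rewrite subr0 => hd; apply: dP; rewrite addrK.
  have gx := nbhs_singleton fg.
  by apply: filterS2 nfg => h fgh; rewrite /= !fctE /= /cst /shift fgh gx.
by apply/diff_locallyP; rewrite (diff_unique dfc go).
Qed.

(** * The operator in one chart: linearity and maximum principle *)

Section levi_form.
Context {R : realType} {n : nat}.
Variable V : set 'rV[R]_n.
Hypothesis oV : open V.
Implicit Types (a b : 'rV[R]_n -> R) (f g : 'rV[R]_n -> R[i]).

Lemma near_open x (P : 'rV[R]_n -> Prop) : V x -> (forall y, V y -> P y) -> \forall y \near x, P y.
Proof. by move=> Vx VP; apply: filterS (open_nbhs_nbhs (conj oV Vx)). Qed.

(** The regularity consumed by a second-order equation. Its stability under linear combinations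
    needs no induction on iterated derivatives. *)
Definition twice_differentiable a : Prop :=
  (forall x, V x -> differentiable a x) /\
  (forall v x, V x -> differentiable ('D_v a) x).

Lemma smooth_on_twice_differentiable a : smooth_on V a -> twice_differentiable a.
Proof. by move=> sa; split=> [|v] x Vx; [exact: (sa [::])|exact: (sa [:: v])]. Qed.

Lemma differentiableDZ (a b : 'rV[R]_n -> R) (e : R) x :
  differentiable a x -> differentiable b x -> differentiable (fun y => a y + e * b y) x.
Proof.
by move=> da db; have := differentiableD da (differentiableZ e db).
Qed.

Lemma twice_differentiableDZ a b (e : R) :
  twice_differentiable a -> twice_differentiable b ->
  twice_differentiable (fun y => a y + e * b y).
Proof.
move=> [da dda] [db ddb]; split=> [|v] x Vx.
  by apply: differentiableDZ; [exact: da|exact: db].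
apply: (near_eq_differentiable (f := fun y => 'D_v a y + e * 'D_v b y)).
  apply: near_open Vx _ => y Vy.
  have d1 : is_derive y v a ('D_v a y).
    by apply: derivableP; apply: diff_derivable; exact: da.
  have d2 : is_derive y v b ('D_v b y).
    by apply: derivableP; apply: diff_derivable; exact: db.
  by have [_ ->] := is_deriveDZ e d1 d2.
by apply: differentiableDZ; [exact: dda|exact: ddb].
Qed.

Variable J : 'rV[R]_n -> 'M[R]_n.
Hypothesis sJ : smooth_on V J.

Definition ctwice f : Prop :=
  twice_differentiable (fun y => complex.Re (f y)) /\
  twice_differentiable (fun y => complex.Im (f y)).

Lemma ctwiceZB (k : R[i]) f g : ctwice f -> ctwice g -> ctwice (fun y => k * (f y - g y)).
Proof.
move=> [fR fI] [gR gI]; case: k => kr ki.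
have t0 : twice_differentiable (fun=> 0).
  split=> [|v] x Vx; first exact: differentiable_cst.
  have -> : 'D_v (fun=> 0 : R) = (fun=> 0) :> ('rV[R]_n -> R).
    by apply/funext => y; exact: derive_cst.
  exact: differentiable_cst.
have dB := twice_differentiableDZ (-1) fR gR; have dB' := twice_differentiableDZ (-1) fI gI.
split.
  have -> : (fun y => complex.Re ((kr +i* ki) * (f y - g y))) = fun y =>
      (0 + kr * (complex.Re (f y) + -1 * complex.Re (g y)))
      + - ki * (complex.Im (f y) + -1 * complex.Im (g y)).
    by apply/funext => y; case: (f y) (g y) => [a b] [c d] /=; ring.
  exact: (twice_differentiableDZ (- ki) (twice_differentiableDZ kr t0 dB) dB').
have -> : (fun y => complex.Im ((kr +i* ki) * (f y - g y))) = fun y =>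
    (0 + kr * (complex.Im (f y) + -1 * complex.Im (g y)))
    + ki * (complex.Re (f y) + -1 * complex.Re (g y)).
  by apply/funext => y; case: (f y) (g y) => [a b] [c d] /=; ring.
exact: (twice_differentiableDZ ki (twice_differentiableDZ kr t0 dB') dB).
Qed.

Lemma near_twice a x : twice_differentiable a -> V x ->
  (\forall y \near x, differentiable a y) /\ (forall w, differentiable ('D_w a) x).
Proof. by move=> [da dda] Vx; split; [exact: near_open da|move=> w; exact: dda]. Qed.

Lemma derivable_dir_sum a b (e : R) x u j : twice_differentiable a -> twice_differentiable b ->
  V x -> derivable (fun y => 'D_(delta_mx 0 j) a y + e * 'D_(row j (J y)) b y) x u.
Proof.
move=> ta tb Vx; have [da dda] := near_twice ta Vx; have [db ddb] := near_twice tb Vx.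
have d1 : is_derive x u ('D_(delta_mx 0 j) a) ('D_u ('D_(delta_mx 0 j) a) x).
  by apply: derivableP; exact: diff_derivable.
have d2 := is_derive_dir_row u j db ddb (sJ [::] Vx).
by have [] := is_deriveDZ e d1 d2.
Qed.

Definition dbar_coord f y := part01 (J y) (d0 f y).

Definition ddbar_coord f x := part11 (J x) (d1 (dbar_coord f) x).

Lemma near_Re_dbar f x j : ctwice f -> V x ->
  \forall y \near x, 2^-1 *: ('D_(delta_mx 0 j) (fun y => complex.Re (f y)) y
     + -1 * 'D_(row j (J y)) (fun y => complex.Im (f y)) y) = complex.Re (dbar_coord f y j 0).
Proof.
move=> [_ [df _]] Vx; apply: near_open Vx _ => y Vy.
by rewrite Re_part01//; exact: df.
Qed.

Lemma near_Im_dbar f x j : ctwice f -> V x ->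
  \forall y \near x, 2^-1 *: ('D_(delta_mx 0 j) (fun y => complex.Im (f y)) y
     + 1 * 'D_(row j (J y)) (fun y => complex.Re (f y)) y) = complex.Im (dbar_coord f y j 0).
Proof.
move=> [[df _] _] Vx; apply: near_open Vx _ => y Vy.
by rewrite Im_part01// ?mul1r//; exact: df.
Qed.

Lemma derivable_dbar f x u j : ctwice f -> V x ->
  derivable (fun y => complex.Re (dbar_coord f y j 0)) x u /\
  derivable (fun y => complex.Im (dbar_coord f y j 0)) x u.
Proof.
move=> tf Vx; have [tR tI] := tf; split.
  apply: near_eq_derivable (near_Re_dbar j tf Vx) _.
  by apply: derivableZ; exact: derivable_dir_sum.
apply: near_eq_derivable (near_Im_dbar j tf Vx) _.
by apply: derivableZ; exact: derivable_dir_sum.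
Qed.

Lemma dbar_coordZB (k : R[i]) f g x : ctwice f -> ctwice g -> V x ->
  dbar_coord (fun y => k * (f y - g y)) x = k *: (dbar_coord f x - dbar_coord g x).
Proof.
move=> [[fR _] [fI _]] [[gR _] [gI _]] Vx.
rewrite /dbar_coord /part01 -mulmxBr scalemxAr; congr (_ *m _).
apply/matrixP => i j; rewrite !mxE cderiveZB//; apply: diff_derivable.
- exact: fR. - exact: fI. - exact: gR. - exact: gI.
Qed.

Lemma cderive_near_eq f g x v : (\forall y \near x, f y = g y) -> cderive v f x = cderive v g x.
Proof.
move=> fg; rewrite /cderive; congr (_ +i* _); apply: near_eq_derive;
  by apply: filterS fg => y ->.
Qed.

Lemma ddbar_coordZB (k : R[i]) f g x : ctwice f -> ctwice g -> V x ->
  ddbar_coord (fun y => k * (f y - g y)) x = k *: (ddbar_coord f x - ddbar_coord g x).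
Proof.
move=> tf tg Vx.
have E i j : cderive (delta_mx 0 i) (fun y => dbar_coord (fun y => k * (f y - g y)) y j 0) x
   = k * (cderive (delta_mx 0 i) (fun y => dbar_coord f y j 0) x
          - cderive (delta_mx 0 i) (fun y => dbar_coord g y j 0) x).
  have [df1 df2] := derivable_dbar (delta_mx 0 i) j tf Vx.
  have [dg1 dg2] := derivable_dbar (delta_mx 0 i) j tg Vx.
  have <- := @cderiveZB _ _ k (fun y => dbar_coord f y j 0) (fun y => dbar_coord g y j 0)
    x (delta_mx 0 i) df1 df2 dg1 dg2.
  apply: cderive_near_eq; apply: near_open Vx _ => y Vy.
  by rewrite dbar_coordZB// !mxE.
have -> : ddbar_coord (fun y => k * (f y - g y)) x = part11 (J x)
    (k *: (d1 (dbar_coord f) x - d1 (dbar_coord g) x)).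
  have aux (p q r s : R[i]) : k * (p - q) - k * (r - s) = k * ((p - r) - (q - s)) by ring.
  rewrite /ddbar_coord; apply: (congr1 (part11 (J x))); apply/matrixP => i j.
  have entry (A B : 'M[R[i]]_n) : (k *: (A - B)) i j = k * (A i j - B i j) by rewrite !mxE.
  have d1E (al : 'rV[R]_n -> 'cV[R[i]]_n) : d1 al x i j = cderive (delta_mx 0 i) (fun y => al y j 0) x
      - cderive (delta_mx 0 j) (fun y => al y i 0) x by rewrite mxE.
  apply: etrans (d1E _) _; apply: etrans (congr2 (fun p q => p - q) (E i j) (E j i)) _.
  apply: etrans (aux _ _ _ _) _; apply: esym; apply: etrans (entry _ _) _.
  exact: (congr2 (fun p q => k * (p - q)) (d1E (dbar_coord f)) (d1E (dbar_coord g))).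
exact: part11ZB.
Qed.

Hypothesis JJ : forall x, V x -> J x *m J x = - 1%:M.

Lemma local_maximum f x0 : ctwice f -> V x0 ->
  (forall x, V x -> ddbar_coord f x = 0) ->
  (forall x, V x -> complex.Re (f x) <= complex.Re (f x0)) ->
  \forall x \near x0, complex.Re (f x) = complex.Re (f x0).
Proof.
move=> tf Vx0 f0 fmax; have [tR tI] := tf.
apply: (strong_max_principle (f := fun y => complex.Re (f y)) oV Vx0) => //.
- exact: tR.1.
- exact: tR.2.
move=> v; exists (fun x => v *m J x).
(* The first-order field of [lop_eq0]; the derivative of [J] along the moving direction v J(x) is
   expanded in the basis to make its continuity in x visible. *)
exists (fun x => v *m (\sum_k (v *m J x) 0 k *: 'D_(delta_mx 0 k) J x)
   - (v *m J x) *m 'D_v J x) => x Vx.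
have dJ : differentiable J x by exact: (sJ [::]).
have cJ : {for x, continuous J} by exact: differentiable_continuous.
have cDJ w : {for x, continuous ('D_w J)}.
  by apply: differentiable_continuous; exact: (sJ [:: w]).
have cv : {for x, continuous (fun=> v)} by exact: cst_continuous.
have cvJ : {for x, continuous (fun y => v *m J y)} by exact: continuous_mulmx.
split; first exact: cvJ.
  apply: continuousB; last exact: continuous_mulmx.
  apply: continuous_rV => j.
  have -> : (fun y => (v *m (\sum_k (v *m J y) 0 k *: 'D_(delta_mx 0 k) J y)) 0 j) =
      fun y => \sum_i \sum_k v 0 i * ((v *m J y) 0 k * 'D_(delta_mx 0 k) J y i j).
    apply/funext => y; rewrite mxE; apply: eq_bigr => i _.
    by rewrite summxE mulr_sumr; apply: eq_bigr => k _; rewrite mxE.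
  apply: continuous_sumr => i; apply: continuous_sumr => k.
  apply: continuousM; first exact: cst_continuous.
  by apply: continuousM; apply: continuous_entry.
rewrite -derive_delta//.
have [daR ddaR] := near_twice tR Vx; have [daI ddaI] := near_twice tI Vx.
apply: (lop_eq0 daR daI) => //; first exact: JJ.
have := @part11_pairing _ _ (J x) (d1 (dbar_coord f) x) (cmx v) (JJ Vx).
rewrite -/(ddbar_coord f x) f0// mulmx0 mul0mx -cmxM.
have -> : (d1 (dbar_coord f) x)^T = - d1 (dbar_coord f) x.
  by apply/matrixP => i j; rewrite !mxE opprB.
move=> /(_ erefl) /matrixP /(_ 0 0) /(congr1 (@complex.Im R)).
(* The factor 2 clears the 1/2 of the (0,1)-projection, so that theta appears without a
   coefficient. *)
rewrite Im_pairing mxE /= => /(congr1 (fun r => 2 * r)); rewrite mulr0 mulr_sumr => E.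
rewrite [RHS]E; apply: eq_bigr => i _; rewrite mulr_sumr; apply: eq_bigr => j _.
have DE p q : complex.Im (cderive (delta_mx 0 p) (fun y => dbar_coord f y q 0) x) =
   2^-1 * 'D_(delta_mx 0 p) (fun y => 'D_(delta_mx 0 q) (fun y => complex.Im (f y)) y
     + 'D_(row q (J y)) (fun y => complex.Re (f y)) y) x.
  rewrite /= -(near_eq_derive _ (near_Im_dbar q tf Vx)) deriveZ.
    by under eq_fun do rewrite mul1r.
  exact: derivable_dir_sum.
rewrite mulrCA; congr (_ * _).
have ImB (p q : R[i]) : complex.Im (p - q) = complex.Im p - complex.Im q.
  by case: p; case: q.
by rewrite mxE ImB !DE -mulrBr mulrA divff ?mul1r// pnatr_eq0.
Qed.

End levi_form.

(** * Manifolds *)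

(** The set of maximum points is nonempty by compactness, open in [Om] by the local hypothesis and
    closed in [Om] by continuity. *)
Lemma connected_max_constant (R : realType) (T : topologicalType) (Om : set T) (w : T -> R) :
  compact Om -> connected Om -> {within Om, continuous w} ->
  (forall p, Om p -> (forall q, Om q -> w q <= w p) ->
     \forall q \near p, Om q -> w q = w p) ->
  forall p q, Om p -> Om q -> w p = w q.
Proof.
move=> cOm connOm cw wloc p q Omp Omq.
have [c /set_mem Omc cmax] := compact_EVT_max (ex_intro _ p Omp) cOm cw.
pose K := Om `&` [set x | w x = w c].
suff KE : K = Om.
  by move: Omp Omq; rewrite -KE => -[_ ->] [_ ->].
apply: connOm.
- by exists c.
- exists [set x | Om x -> w x = w c]^°; first exact: open_interior.
  apply/seteqP; split=> x [Omx wx]; split=> //; last exact: (interior_subset wx).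
  have := wloc x Omx; rewrite wx => /(_ _); apply=> y Omy.
  by apply: cmax; rewrite inE.
- exists (closure K); first exact: closed_closure.
  apply/seteqP; split=> [x Kx|x [Omx clx]].
    by split; [case: Kx|exact: subset_closure].
  split=> //=; apply: contrapT => /eqP wx.
  have := (subspace_continuousP _ _).1 cw x Omx.
  have Nm : nbhs (w x) [set r | r != w c].
    apply: open_nbhs_nbhs; split=> //; exact: open_neq.
  move=> /(_ _ Nm) /= /clx [y [[Omy wy] /(_ Omy) /eqP]]; exact.
Qed.

Section manifolds.
Context {R : realType} {n : nat} {M : almost_complex_manifold R n}.
Implicit Types (U Om : set M) (p q : M) (c : mindex M) (h f u : M -> R[i]).

Lemma smooth_onS (W : normedModType R) (U V : set 'rV[R]_n) (f : 'rV[R]_n -> W) :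
  U `<=` V -> smooth_on V f -> smooth_on U f.
Proof. by move=> UV sf vs x /UV; exact: sf. Qed.

Lemma csmooth_openS U U' h : U `<=` U' -> csmooth_open U' h -> csmooth_open U h.
Proof.
move=> UU' [sR sI]; split=> c; [apply: (smooth_onS _ (sR c))|apply: (smooth_onS _ (sI c))];
  by apply: image_subset; apply: setIS.
Qed.

Lemma smooth_on_cst (W : normedModType R) (U : set 'rV[R]_n) (w : W) :
  smooth_on U (fun=> w).
Proof.
move=> vs x _; have [w' ->] : exists w', iter_derive vs (fun=> w) = (fun=> w') :> ('rV[R]_n -> W).
  elim: vs => [|v vs [w' IH]]; first by exists w.
  by exists 0; apply/funext => y; rewrite /= -/(iter_derive _ _) IH; exact: derive_cst.
exact: differentiable_cst.
Qed.

Lemma csmooth_open0 U : csmooth_open U (fun=> 0 : R[i]).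
Proof. by split=> c; exact: smooth_on_cst. Qed.

Lemma open_chart_image U c : open U -> open (coord (mchart c) @` (cdom (mchart c) `&` U)).
Proof.
move=> oU; rewrite openE => x [q [cq Uq] <-].
have cx : (coord (mchart c) @` cdom (mchart c)) (coord (mchart c) q) by exists q.
have n1 := open_nbhs_nbhs (conj (@cimg_open _ _ _ (mchart c)) cx).
have n2 : \forall y \near coord (mchart c) q, U (param (mchart c) y).
  apply: (param_continuous cx); rewrite coordK//; exact: open_nbhs_nbhs.
apply: filterS2 n1 n2 => y [q' cq' <-]; rewrite coordK// => Uq'.
by exists q'.
Qed.

Lemma smooth_open_continuous U (f : M -> R) p :
  smooth_open U f -> U p -> {for p, continuous f}.
Proof.
move=> sf Up; have [c cp] := mchart_cover p.
have cf : {for coord (mchart c) p, continuous (f \o param (mchart c))}.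
  by apply: differentiable_continuous; apply: (sf c [::]); exists p.
have H : (fun q => f (param (mchart c) (coord (mchart c) q))) @ p --> f p.
  rewrite -[in X in _ --> X](coordK cp).
  exact: (continuous_comp (coord_continuous cp) cf).
apply: cvg_trans H; apply: near_eq_cvg.
apply: filterS (open_nbhs_nbhs (conj (@cdom_open _ _ _ (mchart c)) cp)) => q cq.
by rewrite /= coordK.
Qed.

Lemma ctwice_param U h c : csmooth_open U h ->
  ctwice (coord (mchart c) @` (cdom (mchart c) `&` U)) (h \o param (mchart c)).
Proof.
by move=> [sR sI]; split; apply: smooth_on_twice_differentiable; [exact: sR|exact: sI].
Qed.

Lemma deldbarE h c q : cdom (mchart c) q ->
  deldbar c h q = ddbar_coord (acJ c \o param (mchart c)) (h \o param (mchart c))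
    (coord (mchart c) q).
Proof. by move=> cq; rewrite /ddbar_coord /= coordK. Qed.

(** Formulated for two functions with equal [deldbar] so that it serves both halves of the theorem:
    two local extensions of solutions, or a map and the zero function. *)
Lemma manifold_local_maximum U c p (k : R[i]) h1 h2 :
  open U -> U p -> cdom (mchart c) p ->
  csmooth_open U h1 -> csmooth_open U h2 ->
  (forall q, U q -> cdom (mchart c) q -> deldbar c h1 q = deldbar c h2 q) ->
  (forall q, U q -> complex.Re (k * (h1 q - h2 q)) <= complex.Re (k * (h1 p - h2 p))) ->
  \forall q \near p, complex.Re (k * (h1 q - h2 q)) = complex.Re (k * (h1 p - h2 p)).
Proof.
move=> oU Up cp s1 s2 dd wmax.
set V := coord (mchart c) @` (cdom (mchart c) `&` U).
have oV : open V by exact: open_chart_image.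
have sJ : smooth_on V (acJ c \o param (mchart c)).
  by apply: (smooth_onS _ (@acJ_smooth _ _ M c)); apply: image_subset; exact: subIsetl.
have JJ x : V x -> (acJ c \o param (mchart c)) x *m (acJ c \o param (mchart c)) x = - 1%:M.
  by move=> [q [cq _] <-] /=; rewrite coordK//; exact: acJ_sqr.
have t1 := ctwice_param c s1; have t2 := ctwice_param c s2.
have Vp : V (coord (mchart c) p) by exists p.
have := @local_maximum R n V oV _ sJ JJ _ (coord (mchart c) p) (ctwiceZB oV k t1 t2) Vp.
rewrite /= coordK// => H.
have {}H : \forall x \near coord (mchart c) p,
    complex.Re (k * (h1 (param (mchart c) x) - h2 (param (mchart c) x)))
      = complex.Re (k * (h1 p - h2 p)).
  apply: H => x [q [cq Uq] <-]; last by rewrite coordK//; exact: wmax.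
  rewrite (ddbar_coordZB oV sJ k t1 t2); last by exists q.
  by rewrite -!deldbarE// dd// subrr scaler0.
have {}H : \forall q \near p, complex.Re (k * (h1 (param (mchart c) (coord (mchart c) q))
    - h2 (param (mchart c) (coord (mchart c) q)))) = complex.Re (k * (h1 p - h2 p)).
  exact: (coord_continuous cp H).
have nc := open_nbhs_nbhs (conj (@cdom_open _ _ _ (mchart c)) cp).
by apply: filterS2 nc H => q cq; rewrite coordK.
Qed.

Lemma csmooth_continuous Om u1 u2 (k : R[i]) : csmooth Om u1 -> csmooth Om u2 ->
  {within Om, continuous (fun p => complex.Re (k * (u1 p - u2 p)))}.
Proof.
case: k => kr ki s1 s2; apply/subspace_continuousP => p Omp.
have [h1 [U1 [oU1 U1p [R1 I1] e1]]] := s1 p Omp.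
have [h2 [U2 [oU2 U2p [R2 I2] e2]]] := s2 p Omp.
pose w q := kr * (complex.Re (h1 q) - complex.Re (h2 q))
  - ki * (complex.Im (h1 q) - complex.Im (h2 q)).
have cw : {for p, continuous w}.
  apply: continuousB; apply: continuousM; do ?exact: cst_continuous; apply: continuousB.
  - exact: smooth_open_continuous R1 U1p.
  - exact: smooth_open_continuous R2 U2p.
  - exact: smooth_open_continuous I1 U1p.
  - exact: smooth_open_continuous I2 U2p.
have wE q : complex.Re ((kr +i* ki) * (h1 q - h2 q)) = w q.
  by rewrite /w; case: (h1 q) (h2 q) => [a b] [a' b'].
have : w @ within Om (nbhs p) --> w p by apply: cvg_within_filter.
have -> : w p = complex.Re ((kr +i* ki) * (u1 p - u2 p)) by rewrite -wE e1// e2.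
apply: cvg_trans; apply: near_eq_cvg.
have n1 := open_nbhs_nbhs (conj oU1 U1p); have n2 := open_nbhs_nbhs (conj oU2 U2p).
rewrite near_withinE; apply: filterS2 n1 n2 => q U1q U2q Omq.
by rewrite -wE e1// e2.
Qed.

Lemma boundary_or_interior Om p : Om p -> ~ boundary Om p -> Om^° p.
Proof.
by move=> Omp nb; apply: contrapT => ni; apply: nb; split=> //; exact: subset_closure.
Qed.

(** A positive value somewhere forces every maximum over [Om] to be positive, hence interior. The
    difference is then constant, contrary to its vanishing at the boundary point b. *)
Lemma dirichlet_diff_le0 Om g phi u1 u2 (k : R[i]) :
  compact_domain Om -> boundary Om !=set0 ->
  dirichlet_solution Om g phi u1 -> dirichlet_solution Om g phi u2 ->
  forall p, Om p -> complex.Re (k * (u1 p - u2 p)) <= 0.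
Proof.
move=> [cOm connOm] [b bb] [s1 d1 b1] [s2 d2 b2] p Omp.
rewrite leNgt; apply/negP => wp.
have Omb : Om b.
  by case: bb => + _; apply: compact_closed; first exact: mhausdorff.
pose w q := complex.Re (k * (u1 q - u2 q)).
have wb q : boundary Om q -> w q = 0 by move=> bq; rewrite /w b1// b2// subrr mulr0.
have : w p = w b.
  apply: (connected_max_constant cOm connOm) => //; first exact: csmooth_continuous.
  move=> q Omq wmax.
  have iq : Om^° q.
    apply: boundary_or_interior => // /wb wq0.
    by have := wmax p Omp; rewrite wq0 leNgt wp.
  have [h1 e1] := s1 q Omq; have [h2 e2] := s2 q Omq.
  have [U1 [oU1 U1q sh1 eq1]] := e1; have [U2 [oU2 U2q sh2 eq2]] := e2.
  have [c cq] := mchart_cover q.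
  (* On this set both extensions are smooth and agree with the solutions, and the equation holds at
     each of its points. *)
  pose U := U1 `&` U2 `&` Om^°.
  have oU : open U by do 2?apply: openI => //; exact: open_interior.
  have Uq : U q by [].
  have wE y : U y -> complex.Re (k * (h1 y - h2 y)) = w y.
    by move=> [[U1y U2y] /interior_subset Omy]; rewrite eq1// eq2.
  have := @manifold_local_maximum U c q k h1 h2 oU Uq cq.
  rewrite wE// => H.
  have nU := open_nbhs_nbhs (conj oU Uq).
  have {}H : \forall y \near q, complex.Re (k * (h1 y - h2 y)) = w q.
    apply: H.
    - by apply: csmooth_openS sh1 => y [[]].
    - by apply: csmooth_openS sh2 => y [[]].
    - move=> y [[U1y U2y] /interior_subset Omy] cy.
      by rewrite (d1 y Omy c h1)// ?(d2 y Omy c h2)//; [exists U2|exists U1].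
    - by move=> y Uy; rewrite wE//; apply: wmax; case: Uy => _ /interior_subset.
  by apply: filterS2 nU H => y Uy; rewrite wE.
by rewrite (wb b)// => wp0; move: wp; rewrite -/(w p) wp0 ltxx.
Qed.

(** The multipliers 1, -1, i and -i bound the real and imaginary parts from both sides. *)
Lemma eq0_of_Re_le0 (z : R[i]) : (forall k : R[i], complex.Re (k * z) <= 0) -> z = 0.
Proof.
case: z => a b H; apply/eqP; rewrite eq_complex /= !eq_le.
have := H 1; have := H (-1); have := H (0 +i* 1); have := H (0 +i* -1).
rewrite /= !(mul0r, mul1r, mulN1r, oppr0, sub0r, subr0, opprK) !oppr_le0.
by move=> -> -> -> ->.
Qed.

End manifolds.

(** * Maps to the complex line that are holomorphic for J *)

Section almost_complex_maps.
Context {R : realType} {n : nat} {M : almost_complex_manifold R n}.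
Implicit Types (U Om : set M) (p q : M) (c : mindex M) (h f u : M -> R[i]).

Lemma ddbar_coord_eq0 (V : set 'rV[R]_n) (J : 'rV[R]_n -> 'M[R]_n) (f : 'rV[R]_n -> R[i]) x :
  open V -> V x -> (forall y, V y -> dbar_coord J f y = 0) -> ddbar_coord J f x = 0.
Proof.
move=> oV Vx f0; have -> : ddbar_coord J f x = part11 (J x) 0.
  apply: (congr1 (part11 (J x))); apply/matrixP => i j.
  have c0 k l : cderive (delta_mx 0 k) (fun y => dbar_coord J f y l 0) x = 0.
    rewrite (@cderive_near_eq _ _ _ (fun=> 0)).
      by rewrite /cderive !derive_cst.
    by apply: (near_open oV) Vx _ => y Vy; rewrite f0// mxE.
  by rewrite mxE [RHS]mxE; apply: etrans (congr2 (fun a b => a - b) (c0 i j) (c0 j i)) (subrr _).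
by rewrite /part11 !(mulmx0, mul0mx) addr0.
Qed.

(** The hypothesis says J a = i a, whence (1 + i J) a = a + i^2 a = 0. *)
Lemma dbar_coord_eq0 (J : 'M[R]_n) (a : 'cV[R[i]]_n) :
  (forall v : 'rV[R]_n, cmx (v *m J) *m a = 'i *: (cmx v *m a)) -> part01 J a = 0.
Proof.
move=> Ja; have JE : cmx J *m a = 'i *: a.
  apply/row_matrixP => i; rewrite row_mul linearZ /=.
  have := Ja (delta_mx 0 i); rewrite -rowE /cmx map_row => ->.
  by rewrite map_delta_mx -rowE.
rewrite /part01 /proj01 -scalemxAl mulmxDl mul1mx -scalemxAl JE scalerA -expr2 sqrCi.
by rewrite scaleN1r subrr scaler0.
Qed.

Lemma almost_complex_map_deldbar f h U c q : almost_complex_map f -> open U ->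
  (forall p, U p -> h p = f p) -> U q -> cdom (mchart c) q -> deldbar c h q = 0.
Proof.
move=> [_ Jf] oU hf Uq cq; rewrite deldbarE//.
have oV := @open_chart_image _ _ M U c oU.
apply: (ddbar_coord_eq0 oV); first by exists q.
move=> y Vy; have : \forall z \near y, (h \o param (mchart c)) z = (f \o param (mchart c)) z.
  apply: filterS (open_nbhs_nbhs (conj oV Vy)) => z [r [cr Ur] <-].
  by rewrite /= coordK// hf.
case: Vy => r [cr Ur] <- near_hf; apply: dbar_coord_eq0 => v.
have -> : d0 (h \o param (mchart c)) (coord (mchart c) r) =
    d0 (f \o param (mchart c)) (coord (mchart c) r).
  by apply/matrixP => i j; rewrite !mxE; exact: cderive_near_eq.
by rewrite /= coordK//; exact: Jf.
Qed.

(** With [Om] the whole manifold every point is interior, so the local principle applies wherever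
    the maximum is attained. Writing f as f - 0 fits the two-function form. *)
Lemma almost_complex_map_Re f (k : R[i]) : compact [set: M] -> connected [set: M] ->
  almost_complex_map f -> forall p q, complex.Re (k * f p) = complex.Re (k * f q).
Proof.
move=> cM connM hol p q.
have s0 : csmooth [set: M] (fun=> 0 : R[i]).
  move=> r _; exists (fun=> 0), setT; split=> //; first exact: openT.
  exact: csmooth_open0.
have f0 : f = (fun r => f r - 0) by apply/funext => r; rewrite subr0.
rewrite f0.
apply: (connected_max_constant (w := fun r => complex.Re (k * (f r - 0))) cM connM) => //.
  exact: csmooth_continuous hol.1 s0.
move=> r _ rmax.
have [h [U [oU Ur sh hf]]] := hol.1 r I; have [c cr] := mchart_cover r.
have {}hf y : U y -> h y = f y by exact: hf.
have := @manifold_local_maximum R n M U c r k h (fun=> 0) oU Ur cr sh (csmooth_open0 _).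
rewrite hf// => H.
have {}H : \forall y \near r, complex.Re (k * (h y - 0)) = complex.Re (k * (f r - 0)).
  apply: H => y Uy.
    move=> cy; rewrite (almost_complex_map_deldbar hol oU hf)// deldbarE//.
    apply/esym; have oV := @open_chart_image _ _ M U c oU.
    apply: (ddbar_coord_eq0 oV); first by exists y.
    move=> z _; apply: dbar_coord_eq0 => v.
    have -> : d0 ((fun=> 0 : R[i]) \o param (mchart c)) z = 0.
      by apply/matrixP => i j; rewrite !mxE /cderive !derive_cst.
    by rewrite !mulmx0 scaler0.
  by rewrite hf//; exact: rmax.
by apply: filterS2 (open_nbhs_nbhs (conj oU Ur)) H => y Uy; rewrite hf.
Qed.

End almost_complex_maps.

Theorem corollary4p3 (R : realType) (n : nat) (M : almost_complex_manifold R n) :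
  (forall (Om : set M) (g : mindex M -> M -> 'M[R[i]]_n) (phi : M -> R[i]),
     compact_domain Om -> smooth_boundary Om -> boundary Om !=set0 ->
     smooth_form11 Om g -> csmooth (boundary Om) phi ->
     forall u1 u2 : M -> R[i],
       dirichlet_solution Om g phi u1 -> dirichlet_solution Om g phi u2 ->
       forall p, Om p -> u1 p = u2 p)
  /\
  (compact [set: M] -> connected [set: M] ->
   forall f : M -> R[i], almost_complex_map f ->
     exists k : R[i], forall p, f p = k).
Proof.
split=> [Om g phi cOm _ bOm _ _ u1 u2 s1 s2 p Omp|cM connM f hol].
  apply/eqP; rewrite -subr_eq0; apply/eqP; apply: eq0_of_Re_le0 => k.
  exact: dirichlet_diff_le0 s1 s2 _ Omp.
(* [connected] admits the empty set, so M may be empty; any constant then works. *)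
have [[p _]|noM] := pselect ([set: M] !=set0); last first.
  by exists 0 => p; case: noM; exists p.
exists (f p) => q; apply/eqP; rewrite -subr_eq0; apply/eqP; apply: eq0_of_Re_le0 => k.
have := almost_complex_map_Re k cM connM hol q p.
rewrite mulrBr; case: (k * f q) (k * f p) => [a b] [a' b'] /= ->.
by rewrite subrr.
Qed.
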